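(* Let $d_s,d_u\ge 1$, $d=d_s+d_u$, and consider the system $$\dot z=\Lambda z+F(z),\qquad z\in\mathbb R^d,$$ where $\Lambda=\mathrm{diag}(\lambda_{d_s},\dots,\lambda_1,\mu_1,\dots,\mu_{d_u})\in\mathcal F$ (the set of admissible linear parts defined in the context) and $F(z)=\sum_{|m|\ge 2}c_m z^m$, $c_m\in\mathbb R^d$, is an analytic function (in a neighbourhood of the origin of $\mathbb R^d$). Let $n_1$ be a natural number with $$n_1\ \ge\ \max\left(\left\lceil\frac{\lambda_{d_s}}{\lambda_1}\right\rceil,\left\lceil\frac{\mu_{d_u}}{\mu_1}\right\rceil\right).$$ Then there exist a computable real number $r_\Theta>0$ and analytic maps $\phi$ (a function of $\xi\in\mathbb R^{d_s}$) and $\psi$ (a function of $\eta\in\mathbb R^{d_u}$), with values in $\mathbb R^d$, such that: 1. $\phi(\xi)=\sum_{|m_s|\ge 2}\alpha_{m_s}\xi^{m_s}$ and $\psi(\eta)=\sum_{|m_u|\ge 2}\beta_{m_u}\eta^{m_u}$, with $\alpha_{m_s},\beta_{m_u}\in\mathbb R^d$, where the power series converge for $|\xi|<r_\Theta$ and $|\eta|<r_\Theta$ respectively; 2. $\phi$ and $\psi$ parametrise the local stable and unstable manifolds of the origin: $$W^s_{\mathrm{loc}}=\{(\xi,0)+\phi(\xi):\xi\in U\},\qquad W^u_{\mathrm{loc}}=\{(0,\eta)+\psi(\eta):\eta\in V\},$$ for some neighbourhoods $U\subset\mathbb R^{d_s}$ and $V\subset\mathbb R^{d_u}$ of the respective origins.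 Moreover, with $\Theta(\xi,\eta)=(\xi,\eta)+\phi(\xi)+\psi(\eta)$, the pulled-back vector field near the origin has the form $\Theta^*(\Lambda+F)=\Lambda+G$ with $G|_{E_s}\equiv 0$ and $G|_{E_u}\equiv 0$; 3. for all $|\xi|<r_\Theta$ and all $|\eta|<r_\Theta$, $$\phi(\xi)\in\sum_{2\le|m_s|\le n_1}\alpha_{m_s}\xi^{m_s}+r_\Theta\left(\frac{|\xi|}{r_\Theta}\right)^{n_1+1}\left(1-\frac{|\xi|}{r_\Theta}\right)^{-1}\mathfrak B_1,$$ $$\psi(\eta)\in\sum_{2\le|m_u|\le n_1}\beta_{m_u}\eta^{m_u}+r_\Theta\left(\frac{|\eta|}{r_\Theta}\right)^{n_1+1}\left(1-\frac{|\eta|}{r_\Theta}\right)^{-1}\mathfrak B_1.$$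
   Context: Coordinates: $z=(x,y)\in\mathbb R^{d_s}\times\mathbb R^{d_u}$ and $\zeta=(\xi,\eta)\in\mathbb R^{d_s}\times\mathbb R^{d_u}$. $E_s=\mathbb R^{d_s}\times\{0\}$ and $E_u=\{0\}\times\mathbb R^{d_u}$ are the stable and unstable tangent spaces at the origin. Norm and disc: $|z|=\max_i|z_i|$ (the same sup norm is used on $\mathbb R^{d_s}$ and $\mathbb R^{d_u}$). $\mathfrak B_r=\{|z|<r\}$ is the $r$-disc. For a real number $t$ and a set $X$, $tX=\{tx:x\in X\}$. Multi-indices: $m=(m_s,m_u)\in\mathbb N^{d_s}\times\mathbb N^{d_u}$ with $\mathbb N=\{0,1,2,\dots\}$. The order $|m|=|m_s|+|m_u|$ is the sum of the entries. $m_s\lambda$ denotes the scalar product of $m_s$ with $\lambda=(\lambda_{d_s},\dots,\lambda_1)$, and $m_u\mu$ the scalar product of $m_u$ with $\mu=(\mu_1,\dots,\mu_{d_u})$. Ceiling: $\lceil r\rceil$ denotes the smallest integer (strictly) larger than the real number $r$. Linear parts: $\mathcal S$ is the set of diagonal matrices $\mathrm{diag}(\lambda_{d_s},\dots,\lambda_1,\mu_1,\dots,\mu_{d_u})$ with $\lambda_{d_s}\le\dots\le\lambda_1<0<\mu_1\le\dots\le\mu_{d_u}$. Let $\mathbb V$ be the set of multi-indices $m$ with $|m|\ge 2$ and with $|m_s|=0$ or $|m_u|=0$. Then $\mathcal F=\mathcal F_s\cap\mathcal F_u$, where $$\mathcal F_s=\{\Lambda\in\mathcal S: m\in\mathbb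 V\Rightarrow m_s\lambda-\lambda_i\ne 0,\ 1\le i\le d_s\},$$ $$\mathcal F_u=\{\Lambda\in\mathcal S: m\in\mathbb V\Rightarrow m_u\mu-\mu_i\ne 0,\ 1\le i\le d_u\}.$$ Pullback: $\Theta^*(\Lambda+F)(\zeta)=D\Theta(\zeta)^{-1}\big(\Lambda\Theta(\zeta)+F(\Theta(\zeta))\big)$, defined near the origin, where $D\Theta$ is invertible because $\phi$ and $\psi$ have no constant or linear terms. $W^s_{\mathrm{loc}}$ and $W^u_{\mathrm{loc}}$ denote local stable and unstable manifolds of the hyperbolic fixed point $0$, in the usual sense of the stable manifold theorem. ''Computable'' means that $r_\Theta$ can be obtained by an effective procedure from the data $\Lambda$, $F$, $n_1$. *)

(* Defs.v *)
From HB Require Import structures.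
From mathcomp Require Import all_boot all_order all_algebra.
From mathcomp Require Import all_classical all_reals all_analysis.

Set Implicit Arguments.
Unset Strict Implicit.
Unset Printing Implicit Defensive.

Import Order.TTheory GRing.Theory Num.Theory.
Import numFieldNormedType.Exports.

Local Open Scope classical_set_scope.
Local Open Scope ring_scope.

(* R^n is 'rV[R]_n: vectors are rows, so a matrix A acts by v |-> v *m A, and
   the library's norm on 'rV[R]_n is the sup norm.  A point of
   R^ds x R^du is row_mx x y : 'rV[R]_(ds + du).  *)

Section MultiIndices.
Variable R : realType.

Definition mindex (n : nat) := {ffun 'I_n -> nat}.

Definition mdeg n (m : mindex n) : nat := (\sum_i m i)%N.

Definition mdot n (m : mindex n) (l : 'rV[R]_n) : R := \sum_i (m i)%:R * l 0 i.

Definition monomial n (m : mindex n) (x : 'rV[R]_n) : R := \prod_i x 0 i ^+ m i.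

End MultiIndices.

Section PowerSeries.
Variables (R : realType) (n d : nat).
Implicit Types (a : mindex n -> 'rV[R]_d) (f : 'rV[R]_n -> 'rV[R]_d).

(* The power series with coefficients a converges (absolutely, as usual in
   several variables) at x, with sum v.  *)
Definition pseries_cvg a (x : 'rV[R]_n) (v : 'rV[R]_d) : Prop :=
  (\esum_(m in [set: mindex n]) `|monomial m x *: a m|%:E < +oo)%E /\
  (fun N : nat => \sum_(m \in [set m : mindex n | (mdeg m <= N)%N])
                    monomial m x *: a m) @ \oo --> v.

Definition no_low_terms a : Prop := forall m, (mdeg m < 2)%N -> a m = 0.

Definition analytic_at_origin a f : Prop :=
  \forall x \near (0 : 'rV[R]_n), pseries_cvg a x (f x).

Definition taylor_part a (N : nat) (x : 'rV[R]_n) : 'rV[R]_d :=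
  \sum_(m \in [set m : mindex n | (2 <= mdeg m <= N)%N]) monomial m x *: a m.

(* Cauchy estimate for the coefficients of an analytic function, the constant
   being absorbed in B, which is possible because the series starts in degree
   2.  *)
Definition coef_bound a (B : nat) : Prop :=
  forall m, `|a m| <= B%:R ^+ mdeg m.

Lemma analytic_coef_bound a f :
  no_low_terms a -> analytic_at_origin a f -> exists B, coef_bound a B.
Proof.
move=> a0 /nbhs_ballP[e /= e0 /(_ (const_mx (e / 2)))].
set t := e / 2; have t0 : 0 < t by rewrite divr_gt0.
set x := const_mx t => cvx.
have [sx _] : pseries_cvg a x (f x).
  apply: cvx; rewrite -ball_normE /ball_ /= sub0r normrN.
  apply: (@le_lt_trans _ _ t); last by rewrite /t ltr_pdivrMr// ltr_pMr// ltr1n.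
  rewrite [leLHS]mx_normrE; apply: bigmax_le => [|i _]; first exact: ltW.
  by rewrite mxE gtr0_norm.
have monE (m : mindex n) : monomial m x = t ^+ mdeg m.
  rewrite /monomial /mdeg -prodrXr; apply: eq_bigr => i _.
  by rewrite mxE.
move: sx; set S := (\esum_(m in _) _)%E => sx.
have S0 : (0 <= S)%E by exact: esum_ge0.
have aS m : t ^+ mdeg m * `|a m| <= fine S.
  rewrite -lee_fin fineK ?ge0_fin_numE//.
  have : (`|monomial m x *: a m|%:E <= S)%E.
    by apply: esum_ge; exists [set m]; [split|rewrite fsbig_set1].
  by rewrite normrZ monE ger0_norm// exprn_ge0// ltW.
have C0 : 0 <= (fine S + 1) / t by rewrite divr_ge0 ?addr_ge0 ?fine_ge0// ltW.
exists (Num.bound ((fine S + 1) / t)) => m.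
have [m2|m2] := ltnP (mdeg m) 2; first by rewrite a0// normr0 exprn_ge0.
apply: (@le_trans _ _ (((fine S + 1) / t) ^+ mdeg m)); last first.
  by rewrite lerXn2r ?nnegrE// ltW// archi_boundP.
rewrite expr_div_n ler_pdivlMr ?exprn_gt0// mulrC (le_trans (aS m))//.
have S1 : 1 <= fine S + 1 by rewrite lerDr fine_ge0.
rewrite (@le_trans _ _ (fine S + 1)) ?lerDl// -[leLHS]expr1.
by rewrite ler_weXn2l// ltnW.
Qed.

End PowerSeries.

Definition disc (R : realType) (n : nat) (r : R) : set 'rV[R]_n :=
  [set z | `|z| < r].

Definition scale_set (R : realType) (n : nat) (t : R) (X : set 'rV[R]_n) :
  set 'rV[R]_n := [set t *: x | x in X].

(* The smallest integer strictly larger than x.  *)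
Definition strict_ceil (R : realType) (x : R) : int := Num.floor x + 1.

Section LinearParts.
Variables (R : realType) (ds du : nat).

(* lam and mu list the diagonal in the order of the coordinates: for
   ds = ds'.+1, lam 0 ord0 is lambda_ds and lam 0 ord_max is lambda_1, whereas
   mu 0 ord0 is mu_1.  *)
Implicit Types (lam : 'rV[R]_ds) (mu : 'rV[R]_du).

Definition Lambda lam mu : 'M[R]_(ds + du) := diag_mx (row_mx lam mu).

Definition in_S lam mu : Prop :=
  [/\ {homo lam 0 : i j / (i <= j)%N >-> i <= j},
      forall i, lam 0 i < 0,
      forall i, 0 < mu 0 i
    & {homo mu 0 : i j / (i <= j)%N >-> i <= j}].

Definition in_V (m_s : mindex ds) (m_u : mindex du) : Prop :=
  (2 <= mdeg m_s + mdeg m_u)%N /\ (mdeg m_s = 0%N \/ mdeg m_u = 0%N).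

Definition in_Fs lam mu : Prop :=
  in_S lam mu /\
  forall m_s m_u, in_V m_s m_u -> forall i, mdot m_s lam - lam 0 i <> 0.

Definition in_Fu lam mu : Prop :=
  in_S lam mu /\
  forall m_s m_u, in_V m_s m_u -> forall i, mdot m_u mu - mu 0 i <> 0.

Definition in_F lam mu : Prop := in_Fs lam mu /\ in_Fu lam mu.

End LinearParts.

Section VectorFields.
Variables (R : realType) (d : nat).
Implicit Types (X : 'rV[R]_d -> 'rV[R]_d) (N : set 'rV[R]_d).

Definition vfield (L : 'M[R]_d) (F : 'rV[R]_d -> 'rV[R]_d) (z : 'rV[R]_d) :=
  z *m L + F z.

(* Points of N whose forward orbit stays in N and tends to the origin.  The
   values of u at negative times are irrelevant: a solution on [0, +oo[ always
   extends so as to have a two-sided derivative at 0.  *)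
Definition local_stable_set X N : set 'rV[R]_d :=
  [set z | exists u : R -> 'rV[R]_d,
     [/\ u 0 = z,
         forall t : R, 0 <= t -> is_derive t 1 u (X (u t)),
         forall t, 0 <= t -> N (u t)
       & u t @[t --> +oo] --> (0 : 'rV[R]_d)]].

Definition local_unstable_set X N : set 'rV[R]_d :=
  [set z | exists u : R -> 'rV[R]_d,
     [/\ u 0 = z,
         forall t : R, t <= 0 -> is_derive t 1 u (X (u t)),
         forall t, t <= 0 -> N (u t)
       & u t @[t --> -oo] --> (0 : 'rV[R]_d)]].

(* The local stable/unstable manifold depends on a choice of a small
   neighbourhood N of the fixed point; W N is the local manifold in N.  It is
   parametrised by P, which is defined on D, if for every sufficiently small N
   it is the image by P of a neighbourhood of 0 contained in D.  *)
Definition parametrises k (P : 'rV[R]_k -> 'rV[R]_d) (D : set 'rV[R]_k)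
    (W : set 'rV[R]_d -> set 'rV[R]_d) : Prop :=
  exists2 N0, nbhs (0 : 'rV[R]_d) N0 &
  forall N, nbhs (0 : 'rV[R]_d) N -> N `<=` N0 ->
  exists U, [/\ nbhs (0 : 'rV[R]_k) U, U `<=` D & W N = P @` U].

(* D Theta(zeta)^-1 X(Theta(zeta)); this is meaningful where Theta is
   differentiable with an invertible derivative.  *)
Definition pullback (Theta : 'rV[R]_d -> 'rV[R]_d) X (zeta : 'rV[R]_d) :=
  X (Theta zeta) *m invmx (jacobian Theta zeta).

End VectorFields.

Section ChangeOfVariables.
Variables (R : realType) (ds du : nat).

Definition embed_s (xi : 'rV[R]_ds) : 'rV[R]_(ds + du) := row_mx xi 0.
Definition embed_u (eta : 'rV[R]_du) : 'rV[R]_(ds + du) := row_mx 0 eta.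

Definition Es : set 'rV[R]_(ds + du) := range embed_s.
Definition Eu : set 'rV[R]_(ds + du) := range embed_u.

Definition Theta (phi : 'rV[R]_ds -> 'rV[R]_(ds + du))
    (psi : 'rV[R]_du -> 'rV[R]_(ds + du)) (zeta : 'rV[R]_(ds + du)) :=
  zeta + phi (lsubmx zeta) + psi (rsubmx zeta).

End ChangeOfVariables.

(* Effective procedures: partial recursive functions (Kleene) with access to
   oracles.  *)
Inductive recfun : Type :=
| Zero
| Succ
| Proj of nat
| Oracle of nat
| Comp of recfun & seq recfun
| PrimRec of recfun & recfun
| Mu of recfun.

(* recfun_val O f s v: with the oracles O, the procedure f terminates on the
   arguments s, with value v.  The recursion variable of PrimRec and the search
   variable of Mu are the first argument.  *)
Fixpoint recfun_val (O : nat -> seq nat -> nat) (f : recfun) (s : seq nat)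
    (v : nat) {struct f} : Prop :=
  match f with
  | Zero => v = 0%N
  | Succ => v = (head 0%N s).+1
  | Proj i => v = nth 0%N s i
  | Oracle i => v = O i s
  | Comp g hs => exists2 vs,
      (fix vals (hs : seq recfun) (vs : seq nat) : Prop :=
         match hs, vs with
         | [::], [::] => True
         | h :: hs', w :: vs' => recfun_val O h s w /\ vals hs' vs'
         | _, _ => False
         end) hs vs
      & recfun_val O g vs v
  | PrimRec g h => exists w : nat -> nat,
      [/\ recfun_val O g (behead s) (w 0%N),
          forall i, (i < head 0%N s)%N ->
            recfun_val O h [:: i, w i & behead s] (w i.+1)
        & v = w (head 0%N s)]
  | Mu g => recfun_val O g (v :: s) 0%N /\
      forall i, (i < v)%N -> exists w, recfun_val O g (i :: s) w.+1
  end.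

Section ComputableReals.
Variable R : realType.

Definition int_of_code (n : nat) : int := if odd n then Negz n./2 else Posz n./2.

(* n codes an integer a such that a / 2^k is within 2^-k of x.  *)
Definition approx (k n : nat) (x : R) : Prop :=
  `|x - (int_of_code n)%:~R / 2 ^+ k| <= (2 ^+ k)^-1.

(* Oracle 0 gives, on input (i, k), an approximation of order k of the i-th
   diagonal entry; oracle 1 gives, on input (j, k, m), one of the j-th component
   of the coefficient of z^m.  *)
Definition describes (O : nat -> seq nat -> nat) d (l : 'rV[R]_d)
    (c : mindex d -> 'rV[R]_d) : Prop :=
  (forall (i : 'I_d) k, approx k (O 0%N [:: nat_of_ord i; k]) (l 0 i)) /\
  (forall (j : 'I_d) k (m : mindex d),
     approx k (O 1%N [:: nat_of_ord j, k & codom m]) (c m 0 j)).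

(* From any description of the linear part and of the Taylor coefficients,
   given n1 and the coefficient bound B, the procedure e computes r to any
   prescribed accuracy 2^-k.  B is part of the data representing the analytic
   function: finitely many coefficients, which is all that a procedure can
   query, say nothing about the radius of convergence.  *)
Definition computes_from_data (e : recfun) d (l : 'rV[R]_d)
    (c : mindex d -> 'rV[R]_d) (n1 B : nat) (r : R) : Prop :=
  forall O, describes O l c ->
  forall k, exists2 v, recfun_val O e [:: n1; B; k] v & approx k v r.

End ComputableReals.

(* Main.v *)
From HB Require Import structures.
From mathcomp Require Import all_boot all_order all_algebra.
From mathcomp Require Import all_classical all_reals all_analysis.
From mathcomp Require Import ring lra.
From mathcomp Require Import -(notations) mpoly.
Require Import Defs.
Import Order.TTheory GRing.Theory Num.Theory.
Import numFieldNormedType.Exports.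
Set Implicit Arguments.
Unset Strict Implicit.
Unset Printing Implicit Defensive.
Local Open Scope classical_set_scope.
Local Open Scope ring_scope.

(** The graph of the local stable manifold is sought as xi + phi xi with the
extra demand that the flow on it be linear in the parameter xi.  This is the
invariance equation  D phi(xi) (Lambda xi) - Lambda phi(xi) = F(xi + phi xi),
and on coefficients it reads  (m.lambda - l_i) alpha_{m,i} = [F(xi + phi xi)]_{m,i}.
As F starts in degree 2, the right-hand side only involves coefficients of
lower degree, and the divisors do not vanish: for i stable by non-resonance, for
i unstable because m.lambda and -l_i are both negative.  All stable eigenvalues
being negative, the divisors moreover stay away from 0: once |m| is at least
1 plus the ratio of the extreme eigenvalues they are at least |lambda_1|, so a
positive lower bound gam is found from finitely many m (gap_le_stable_divisor,
gap_le_unstable_divisor).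

Convergence is a majorant argument.  Polynomial truncations of phi are produced
by an iteration (approx_sol); in the weighted l1 norm of radius rho, composition
with F costs a factor bounded through |c_m| <= B^|m|, division by the divisors
costs 1/gam, and for rho of the order of gam / (B + 1)^2 the ball of radius rho
is preserved (sum_pnorm_approx_sol).  Hence the coefficients of phi have weighted
sum at most rho, and since the announced radius r is rho / 2, every tail beyond
degree n1 is at most r (|xi| / r)^(n1 + 1) (phi_tail_bound).

That the formal solution solves the actual equation is proved without
rearranging infinite sums: each truncation solves it up to a polynomial of high
order and bounded norm, which tends to 0 on half the radius (formal_invariance,
invariance).

The invariance equation makes every point of the graph start an orbit tending to
0 (stable_orbit).  Conversely, along the difference of two orbits that stay near
0, the sum of the squares of the unstable coordinates minus that of the stable
ones is nondecreasing and tends to 0; hence two such orbits with the same initial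
stable coordinates coincide (orbits_coincide).  Comparing an arbitrary orbit of
the local stable set with the orbit on the graph that has the same initial
stable coordinates shows that the former starts on the graph
(parametrises_stable).  The unstable manifold is the stable manifold of the
reversed field -X.

On E_s the derivative of Theta is the derivative of the parametrisation, because
D psi(0) acts on a zero vector there; so the invariance equation says exactly
that the pulled-back field is linear on E_s, and likewise on E_u.

Finally r = gam / C with C an explicit natural number, where gam is the minimum
of 1, the |l_i| and the finitely many divisors with exponents at most n1: a
continuous function of the eigenvalues, so that approximations of these yield
approximations of r, whichever approximations are supplied
(radius_code_correct).  *)

(** * Finite sums over multi-indices *)

(** The join of completeness and norm on matrices, for the Cauchy criterion on
partial sums of vectors. *)
HB.instance Definition _ (R : realType) m n := Complete.on 'M[R]_(m, n).

Section SupNorm.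
Variables (R : realType) (n : nat).
Implicit Types x y : 'rV[R]_n.

Lemma norm_coord x i : `|x 0 i| <= `|x|.
Proof.
by rewrite [leRHS]/Num.Def.normr/= mx_normrE; exact: (le_bigmax _ _ (0, i)).
Qed.

Lemma norm_le_coord x e : 0 <= e -> (forall i, `|x 0 i| <= e) -> `|x| <= e.
Proof.
move=> e0 xe; rewrite [leLHS]/Num.Def.normr/= mx_normrE.
by apply: bigmax_le => // -[i j] _ /=; rewrite ord1.
Qed.

Lemma norm_le_sum x : `|x| <= \sum_i `|x 0 i|.
Proof.
apply: norm_le_coord => [|i]; first exact: sumr_ge0.
by rewrite (bigD1 i)//= lerDl sumr_ge0.
Qed.

End SupNorm.

Lemma cvg_norm_le (R : realType) (V : normedModType R) (u : nat -> V) (l : V)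
    (C : R) :
  u @ \oo --> l -> (\forall N \near \oo, `|u N| <= C) -> `|l| <= C.
Proof.
move=> ul uC; have nul : (fun N => `|u N|) @ \oo --> `|l| by exact: cvg_norm.
rewrite -(cvg_lim _ nul)//; apply: limr_le => //.
by apply/cvg_ex; exists `|l|.
Qed.

Section MultiIndexEnumeration.
Variable n : nat.

(** A list rather than a set, so that sums over it are plain big operators and
lists for different degrees can be compared up to permutation. *)
Definition multis N : seq (mindex n) :=
  [seq m <- [seq [ffun i => val (f i)] | f : {ffun 'I_n -> 'I_N.+1}]
  | mdeg m <= N]%N.

Lemma mem_multis N m : (m \in multis N) = (mdeg m <= N)%N.
Proof.
rewrite mem_filter andb_idr// => mN; apply/mapP.
exists [ffun i => inord (m i)]; first by rewrite mem_enum.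
apply/ffunP => i; rewrite !ffunE /= inordK// ltnS (leq_trans _ mN)//.
by rewrite /mdeg (bigD1 i)//= leq_addr.
Qed.

Lemma multis_uniq N : uniq (multis N).
Proof.
rewrite filter_uniq// map_inj_uniq ?enum_uniq// => f g /ffunP fg.
by apply/ffunP => i; apply: val_inj; have := fg i; rewrite !ffunE.
Qed.

Lemma big_multis_le (V : nmodType) K N (g : mindex n -> V) : (K <= N)%N ->
  \sum_(m <- multis N | (mdeg m <= K)%N) g m = \sum_(m <- multis K) g m.
Proof.
move=> KN; rewrite -big_filter; apply: perm_big; apply: uniq_perm.
- by rewrite filter_uniq// multis_uniq.
- exact: multis_uniq.
- move=> m; rewrite mem_filter !mem_multis andb_idr// => mK.
  exact: leq_trans mK KN.
Qed.

Lemma big_multis_split (V : nmodType) K N (g : mindex n -> V) : (K <= N)%N ->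
  \sum_(m <- multis N) g m =
  \sum_(m <- multis K) g m + \sum_(m <- multis N | (K < mdeg m)%N) g m.
Proof.
move=> KN; rewrite (bigID (fun m => (mdeg m <= K)%N))/= big_multis_le//.
by congr (_ + _); apply: eq_bigl => m; rewrite -ltnNge.
Qed.

Lemma multis_set N : [set m : mindex n | (mdeg m <= N)%N] = [set` multis N].
Proof. by apply/seteqP; split => m /=; rewrite mem_multis. Qed.

Lemma fsbig_multis (V : nmodType) N (g : mindex n -> V) :
  \sum_(m \in [set m : mindex n | (mdeg m <= N)%N]) g m =
  \sum_(m <- multis N) g m.
Proof. by rewrite multis_set -fsbig_seq//; exact: multis_uniq. Qed.

Lemma seq_mdeg_bounded (s : seq (mindex n)) :
  exists N, forall m, m \in s -> (mdeg m <= N)%N.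
Proof.
exists (\max_(m <- s) mdeg m)%N => m ms.
exact: (@leq_bigmax_seq _ s xpredT (@mdeg n) m).
Qed.

End MultiIndexEnumeration.

Section DominatedSums.
Variables (R : realType) (n d : nat) (a : mindex n -> 'rV[R]_d) (rho M : R).

(** The form in which convergence is used below: a bound on all partial sums of
the majorant at radius rho.  Every vector-valued series that is
termwise smaller is then controlled by finite sums. *)
Definition coef_sum_le :=
  forall N, \sum_(m <- multis n N) `|a m| * rho ^+ mdeg m <= M.

Hypotheses (rho0 : 0 <= rho) (aM : coef_sum_le).

Variables (V : normedModType R) (g : mindex n -> V).

Lemma dominated_sum_le C N : 0 <= C ->
  (forall m, `|g m| <= C * (`|a m| * rho ^+ mdeg m)) ->
  `|\sum_(m <- multis n N) g m| <= C * M.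
Proof.
move=> C0 gC; apply: le_trans (ler_norm_sum _ _ _) _.
apply: (@le_trans _ _ (\sum_(m <- multis n N) C * (`|a m| * rho ^+ mdeg m))).
  exact: ler_sum.
by rewrite -mulr_sumr ler_wpM2l.
Qed.

Lemma dominated_tail_le C K N : (K <= N)%N -> 0 <= C ->
  (forall m, (K < mdeg m)%N -> `|g m| <= C * (`|a m| * rho ^+ mdeg m)) ->
  `|\sum_(m <- multis n N) g m - \sum_(m <- multis n K) g m| <= C * M.
Proof.
move=> KN C0 gC; rewrite (big_multis_split _ KN) addrC addKr.
apply: le_trans (ler_norm_sum _ _ _) _.
apply: (@le_trans _ _ (\sum_(m <- multis n N | (K < mdeg m)%N)
                          C * (`|a m| * rho ^+ mdeg m))).
  exact: ler_sum.
rewrite -mulr_sumr ler_wpM2l//; apply: le_trans (aM N).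
rewrite big_mkcond/=; apply: ler_sum => m _; case: ifP => // _.
by rewrite mulr_ge0// exprn_ge0.
Qed.

End DominatedSums.

Section GeometricDomination.
Variables (R : realType) (n d : nat) (a : mindex n -> 'rV[R]_d) (rho M : R).
Hypotheses (rho0 : 0 <= rho) (aM : coef_sum_le a rho M).
Variables (V : completeNormedModType R) (g : mindex n -> V) (C q : R).
Hypotheses (C0 : 0 <= C) (q0 : 0 <= q) (q1 : q < 1).
Hypothesis gC : forall m, `|g m| <= C * q ^+ mdeg m * (`|a m| * rho ^+ mdeg m).

Let gtail K N : (K <= N)%N ->
  `|\sum_(m <- multis n N) g m - \sum_(m <- multis n K) g m|
  <= C * q ^+ K.+1 * M.
Proof.
move=> KN; apply: (dominated_tail_le rho0 aM KN).
  by rewrite mulr_ge0// exprn_ge0.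
move=> m Km; apply: le_trans (gC m) _.
rewrite ler_wpM2r ?mulr_ge0 ?exprn_ge0// ler_wpM2l//.
by rewrite ler_wiXn2l// ltW.
Qed.

Let gsmall : (fun K => C * q ^+ K.+1 * M) @ \oo --> (0 : R).
Proof.
have qn : (fun K => q ^+ K) @ \oo --> (0 : R) by apply: cvg_expr; rewrite ger0_norm.
have qn1 : (fun K => q ^+ K.+1) @ \oo --> (0 : R).
  by have := qn; rewrite -(cvg_shiftS (fun K => q ^+ K)).
rewrite -[X in _ --> X](mul0r M) -[X in X * M](mulr0 C).
by apply: cvgM; [apply: cvgM; [exact: cvg_cst|]|exact: cvg_cst].
Qed.

(** The factor q ^+ mdeg m bounds the tail beyond degree K by q ^+ K.+1 times
the majorant, so the partial sums form a Cauchy sequence. *)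
Lemma dominated_cvg : cvg ((fun N => \sum_(m <- multis n N) g m) @ \oo).
Proof.
apply: cauchy_cvg; apply: cauchy_exP => e e0.
have /cvgr0Pnorm_lt/(_ e e0)[K _ Ke] := gsmall.
exists (\sum_(m <- multis n K) g m), K => // N /= KN.
rewrite -ball_normE /ball_ /= distrC.
apply: le_lt_trans (gtail KN) _.
by apply: le_lt_trans (Ke K _) => //=; rewrite ler_norm.
Qed.

Lemma dominated_lim_tail_le K :
  `|lim ((fun N => \sum_(m <- multis n N) g m) @ \oo) - \sum_(m <- multis n K) g m|
  <= C * q ^+ K.+1 * M.
Proof.
have := dominated_cvg; set S := fun N => _ => cS.
have cS' : (fun N => S N - S K) @ \oo --> lim (S @ \oo) - S K.
  by apply: cvgB => //; exact: cvg_cst.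
apply: cvg_norm_le cS' _.
by exists K => // N /= KN; exact: gtail.
Qed.

End GeometricDomination.

(** * First-order expansions of monomials *)

(** A quadratic remainder is a little-o of the increment.  The
parametrisations and Theta are differentiated by exhibiting their derivative
and such a remainder. *)
Lemma quadratic_differentiable (R : realType) (V W : normedModType R)
    (f : V -> W) (L : {linear V -> W}) x (C delta : R) :
  continuous L -> 0 < delta ->
  (forall h, `|h| < delta ->
     `|f (h + x) - f x - L h| <= C * `|h| ^+ 2) ->
  differentiable f x /\ ('d f x = L :> (V -> W)).
Proof.
move=> cL d0 fC.
have fo : f \o shift x = cst (f x) + L +o_ 0 id.
  apply/eqaddoP => e e0; near=> h.
  rewrite [X in `|X|](_ : _ = f (h + x) - f x - L h); last first.
    by rewrite !fctE opprD addrA.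
  apply: le_trans (fC h _) _.
    by near: h; apply: nbhs0_lt.
  rewrite expr2 mulrA ler_wpM2r//.
  near: h; have [C0|C0] := leP C 0.
    near=> h; rewrite (le_trans _ (ltW e0))// mulr_le0_ge0//.
  near=> h; rewrite -ler_pdivlMl//.
  by near: h; apply: nbhs0_le; rewrite mulr_gt0 ?invr_gt0.
have dfL := diff_unique cL fo.
by split=> //; apply/diff_locallyP; rewrite dfL.
Unshelve. all: by end_near. Qed.

Section RowLinear.
Variables (R : realType) (n d : nat).
Implicit Types (J : 'M[R]_(n, d)) (h x : 'rV[R]_n).

Lemma mulmx_bounded J : exists2 K, 0 <= K & forall h, `|h *m J| <= K * `|h|.
Proof.
exists (\sum_i \sum_j `|J i j|).
  by apply: sumr_ge0 => i _; apply: sumr_ge0.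
move=> h; apply: norm_le_coord => [|j].
  by rewrite mulr_ge0//; apply: sumr_ge0 => i _; apply: sumr_ge0.
rewrite mxE; apply: le_trans (ler_norm_sum _ _ _) _.
rewrite mulr_suml; apply: ler_sum => i _.
rewrite normrM mulrC ler_pM// ?norm_coord//.
by rewrite (bigD1 j)//= lerDl sumr_ge0.
Qed.

Lemma mulmxr_continuous J : continuous (mulmxr J : 'rV[R]_n -> 'rV[R]_d).
Proof.
have [K K0 JK] := mulmx_bounded J.
apply: bounded_linear_continuous; apply/linear_boundedP.
near=> r => x /=; apply: le_trans (JK x) _.
by rewrite ler_wpM2r//; near: r; apply: nbhs_pinfty_ge; rewrite num_real.
Unshelve. all: by end_near. Qed.

Lemma quadratic_jacobian (f : 'rV[R]_n -> 'rV[R]_d) x J (C delta : R) :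
  0 < delta ->
  (forall h, `|h| < delta -> `|f (h + x) - f x - h *m J| <= C * `|h| ^+ 2) ->
  differentiable f x /\ jacobian f x = J.
Proof.
move=> d0 fC; have [df dE] := quadratic_differentiable (@mulmxr_continuous J) d0 fC.
split=> //; apply/row_matrixP => i; rewrite !rowE.
by rewrite -deriveEjacobian// deriveE// dE.
Qed.

End RowLinear.

Section Words.
Variables (R : realType) (n : nat).
Implicit Types (w : seq 'I_n) (x y h : 'rV[R]_n) (s : R).

(** Monomials are handled as products over the letters of a word, so that
estimates go by induction on the word instead of on exponents. *)
Definition wmon w x : R := \prod_(i <- w) x 0 i.

(** The derivative at x in the direction h, by the Leibniz rule along the word. *)
Fixpoint wder w x h : R :=
  if w is i :: w' then h 0 i * wmon w' x + x 0 i * wder w' x h else 0.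

Lemma wmon_cons i w x : wmon (i :: w) x = x 0 i * wmon w x.
Proof. exact: big_cons. Qed.

Lemma wmon_le w x s : `|x| <= s -> `|wmon w x| <= s ^+ size w.
Proof.
move=> xs; elim: w => [|i w IH] /=; first by rewrite /wmon big_nil normr1.
rewrite wmon_cons normrM exprS ler_pM//.
exact: le_trans (norm_coord x i) xs.
Qed.

(** The factor s on the left stands for the missing exponent (size w).-1, whose
first value would need a separate case. *)
Lemma wder_le w x h s : `|x| <= s ->
  s * `|wder w x h| <= (size w)%:R * s ^+ size w * `|h|.
Proof.
move=> xs; have s0 : 0 <= s by rewrite (le_trans _ xs).
elim: w => [|i w IH] /=; first by rewrite normr0 mulr0 !mul0r.
apply: (@le_trans _ _ (s * (`|h| * s ^+ size w + s * `|wder w x h|))).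
  rewrite ler_wpM2l//; apply: le_trans (ler_normD _ _) _; rewrite !normrM.
  rewrite lerD// ler_pM ?norm_coord ?wmon_le//.
  exact: le_trans (norm_coord x i) xs.
rewrite [leRHS](_ : _ = s * (`|h| * s ^+ size w
    + (size w)%:R * s ^+ size w * `|h|)); last by rewrite -natr1 exprS; ring.
by rewrite ler_wpM2l// lerD2l.
Qed.

Lemma wmon_lipschitz w x y s : `|x| <= s -> `|y| <= s ->
  s * `|wmon w x - wmon w y| <= (size w)%:R * s ^+ size w * `|x - y|.
Proof.
move=> xs ys; have s0 : 0 <= s by rewrite (le_trans _ xs).
elim: w => [|i w IH] /=; first by rewrite /wmon !big_nil subrr normr0 mulr0 !mul0r.
rewrite !wmon_cons.
have -> : x 0 i * wmon w x - y 0 i * wmon w y =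
  (x - y) 0 i * wmon w x + y 0 i * (wmon w x - wmon w y) by rewrite !mxE; ring.
apply: (@le_trans _ _ (s * (`|x - y| * s ^+ size w
                            + s * `|wmon w x - wmon w y|))).
  rewrite ler_wpM2l//; apply: le_trans (ler_normD _ _) _; rewrite !normrM.
  rewrite lerD// ler_pM ?norm_coord ?wmon_le//.
  exact: le_trans (norm_coord y i) ys.
rewrite [leRHS](_ : _ = s * (`|x - y| * s ^+ size w
    + (size w)%:R * s ^+ size w * `|x - y|)); last by rewrite -natr1 exprS; ring.
by rewrite ler_wpM2l// lerD2l.
Qed.

Lemma wmon_taylor1 w x h s : `|x| <= s -> `|h + x| <= s ->
  s ^+ 2 * `|wmon w (h + x) - wmon w x - wder w x h|
  <= (size w)%:R ^+ 2 * s ^+ size w * `|h| ^+ 2.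
Proof.
move=> xs ys; have s0 : 0 <= s by rewrite (le_trans _ xs).
elim: w => [|i w IH] /=.
  by rewrite /wmon !big_nil subrr subr0 normr0 mulr0 expr0n/= !mul0r.
rewrite !wmon_cons; set y := h + x.
have -> : y 0 i * wmon w y - x 0 i * wmon w x
            - (h 0 i * wmon w x + x 0 i * wder w x h) =
  y 0 i * (wmon w y - wmon w x - wder w x h) + h 0 i * wder w x h.
  by rewrite /y !mxE; ring.
apply: (@le_trans _ _ (s ^+ 2 * (s * `|wmon w y - wmon w x - wder w x h|
                            + `|h| * `|wder w x h|))).
  rewrite ler_wpM2l ?exprn_ge0//; apply: le_trans (ler_normD _ _) _.
  rewrite !normrM lerD// ler_wpM2r// ?norm_coord//.
  exact: le_trans (norm_coord y i) ys.
apply: (@le_trans _ _ (s * ((size w)%:R ^+ 2 * s ^+ size w * `|h| ^+ 2)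
                       + s * `|h| * ((size w)%:R * s ^+ size w * `|h|))).
  rewrite mulrDr lerD//; first by rewrite mulrCA ler_wpM2l.
  rewrite (_ : s ^+ 2 * _ = s * `|h| * (s * `|wder w x h|)); last by ring.
  by rewrite ler_wpM2l ?mulr_ge0// wder_le.
rewrite -natr1 (exprS s (size w)) -subr_ge0.
set k := (size w)%:R; set t := s ^+ _; set e := `|h|.
have k0 : 0 <= k by rewrite ler0n.
rewrite (_ : _ - _ = (k + 1) * (s * t) * e ^+ 2); last by ring.
apply: mulr_ge0; last by rewrite exprn_ge0 ?normr_ge0.
by rewrite mulr_ge0 ?addr_ge0 ?mulr_ge0 ?exprn_ge0.
Qed.

Lemma wder_sum w x h :
  wder w x h = \sum_i h 0 i * wder w x (delta_mx 0 i).
Proof.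
elim: w => [|j w IH] /=; first by rewrite big1// => i _; rewrite mulr0.
rewrite IH mulr_sumr.
under [RHS]eq_bigr do rewrite mulrDr mulrA [h 0 _ * (x 0 j * _)]mulrCA.
rewrite big_split/= -mulr_suml; congr (_ * _ + _).
rewrite (bigD1 j)//= mxE !eqxx mulr1 big1 ?addr0// => i ij.
by rewrite mxE eqxx/= eq_sym (negbTE ij) mulr0.
Qed.

(** A monomial is an eigenvector of the derivation along a diagonal linear field.
This is what turns the invariance equation into one scalar equation for each
coefficient. *)
Lemma wder_euler w x (l : 'rV[R]_n) :
  wder w x (x *m diag_mx l) = (\sum_(i <- w) l 0 i) * wmon w x.
Proof.
elim: w => [|j w IH] /=; first by rewrite big_nil mul0r.
rewrite IH big_cons wmon_cons mulrDl (mulrCA (x 0 j)); congr (_ + _).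
rewrite mul_mx_diag mxE; ring.
Qed.

Definition mword (m : mindex n) : seq 'I_n :=
  flatten [seq nseq (m i) i | i <- index_enum 'I_n].

Lemma big_mword (T : Type) (idx : T) (op : Monoid.law idx) (m : mindex n)
    (F : 'I_n -> T) :
  \big[op/idx]_(i <- mword m) F i = \big[op/idx]_i iter (m i) (op (F i)) idx.
Proof.
rewrite /mword big_flatten big_map; apply: eq_bigr => i _.
exact: big_nseq.
Qed.

Lemma size_mword m : size (mword m) = mdeg m.
Proof.
rewrite -sum1_size big_mword; apply: eq_bigr => i _.
by rewrite iter_addn_0 mul1n.
Qed.

Lemma wmon_mword m x : wmon (mword m) x = monomial m x.
Proof.
rewrite /wmon big_mword; apply: eq_bigr => i _.
by rewrite iter_mulr_1.
Qed.

Lemma sum_mword m (l : 'rV[R]_n) : \sum_(i <- mword m) l 0 i = mdot m l.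
Proof.
rewrite big_mword; apply: eq_bigr => i _.
by rewrite iter_addr_0 mulr_natl.
Qed.

End Words.

(** * Sums of power series *)

Section PowerBounds.
Variable R : realType.
Implicit Types (k : nat) (s : R).

Lemma nat_le_pow2 k : k%:R <= 2 ^+ k :> R.
Proof. by rewrite -natrX ler_nat ltnW// ltn_expl. Qed.

(** Polynomial factors in the degree, which come from differentiating, are absorbed
by shrinking the radius. *)
Lemma nat_pow_le k s : 0 <= s -> k%:R * s ^+ k <= (2 * s) ^+ k.
Proof. by move=> s0; rewrite exprMn ler_wpM2r ?exprn_ge0// nat_le_pow2. Qed.

Lemma nat2_pow_le k s : 0 <= s -> k%:R ^+ 2 * s ^+ k <= (4 * s) ^+ k.
Proof.
move=> s0; rewrite exprMn ler_wpM2r ?exprn_ge0//.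
have -> : 4 = 2 ^+ 2 :> R by ring.
rewrite -exprM mulnC exprM.
by apply: lerXn2r; rewrite ?nnegrE ?exprn_ge0// nat_le_pow2.
Qed.

End PowerBounds.

Section PowerSeriesSum.
Variables (R : realType) (n d : nat) (a : mindex n -> 'rV[R]_d).
Implicit Types (x y h : 'rV[R]_n).

Definition psum N x : 'rV[R]_d := \sum_(m <- multis n N) monomial m x *: a m.

Definition pfun x : 'rV[R]_d := lim ((fun N => psum N x) @ \oo).

Definition mder (m : mindex n) x h : R := wder (mword m) x h.

Definition dsum N x h : 'rV[R]_d := \sum_(m <- multis n N) mder m x h *: a m.

(** Row i is the limit of the termwise derivatives in the direction i. *)
Definition pder x : 'M[R]_(n, d) :=
  \matrix_(i, j) lim ((fun N => dsum N x (delta_mx 0 i)) @ \oo) 0 j.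

Lemma psum_fsbig N x :
  \sum_(m \in [set m : mindex n | (mdeg m <= N)%N]) monomial m x *: a m
  = psum N x.
Proof. exact: fsbig_multis. Qed.

Lemma monomial_le m x s : `|x| <= s -> `|monomial m x| <= s ^+ mdeg m.
Proof. by move=> xs; rewrite -wmon_mword -size_mword; exact: wmon_le. Qed.

Lemma dsum_euler N x (l : 'rV[R]_n) :
  dsum N x (x *m diag_mx l) =
  \sum_(m <- multis n N) (mdot m l * monomial m x) *: a m.
Proof.
by apply: eq_bigr => m _; rewrite /mder wder_euler sum_mword wmon_mword.
Qed.

Lemma dsum_sum N x h :
  dsum N x h = \sum_i h 0 i *: dsum N x (delta_mx 0 i).
Proof.
under [RHS]eq_bigr do rewrite scaler_sumr.
rewrite exchange_big/=; apply: eq_bigr => m _.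
by rewrite {1}/mder wder_sum scaler_suml; apply: eq_bigr => i _; rewrite scalerA.
Qed.

Variables (rho M : R).
Hypotheses (rho0 : 0 < rho) (aM : coef_sum_le a rho M).

Let monomial_dominated x q m : 0 <= q -> `|x| <= q * rho ->
  `|monomial m x *: a m| <= 1 * q ^+ mdeg m * (`|a m| * rho ^+ mdeg m).
Proof.
move=> q0 xq; rewrite normrZ mul1r mulrCA -exprMn mulrC.
by rewrite ler_wpM2l// monomial_le.
Qed.

Lemma psum_cvg x q : 0 <= q -> q < 1 -> `|x| <= q * rho ->
  (fun N => psum N x) @ \oo --> pfun x.
Proof.
move=> q0 q1 xq.
exact: (dominated_cvg (ltW rho0) aM ler01 q0 q1
          (fun m => monomial_dominated m q0 xq)).
Qed.

Lemma pfun_tail_le x q K : 0 <= q -> q < 1 -> `|x| <= q * rho ->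
  `|pfun x - psum K x| <= q ^+ K.+1 * M.
Proof.
move=> q0 q1 xq; have := dominated_lim_tail_le (ltW rho0) aM ler01 q0 q1
  (fun m => monomial_dominated m q0 xq) K.
by rewrite mul1r.
Qed.

Let radius_ratio x : `|x| < rho ->
  [/\ 0 <= `|x| / rho, `|x| / rho < 1 & `|x| <= `|x| / rho * rho].
Proof.
move=> xr; split; first by rewrite divr_ge0// ltW.
  by rewrite ltr_pdivrMr// mul1r.
by rewrite divfK// gt_eqF.
Qed.

(** Any finite family of multi-indices is contained in some multis n N, hence the
unordered sum of the norms is at most M. *)
Lemma pseries_cvg_pfun x : `|x| < rho -> pseries_cvg a x (pfun x).
Proof.
move=> xr; split; last first.
  have [q0 q1 xq] := radius_ratio xr.
  rewrite (_ : (fun N : nat => _) = (fun N => psum N x)); first exact: psum_cvg xq.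
  by apply/funext => N; exact: psum_fsbig.
apply: (@le_lt_trans _ _ M%:E); last exact: ltry.
apply: ub_ereal_sup => _ [A [finA _] <-].
have [s sA] := (finite_seqP A).1 finA.
pose s' := undup s.
have {}sA : A = [set` s'].
  by rewrite sA; apply/seteqP; split => m /=; rewrite mem_undup.
have us : uniq s' by exact: undup_uniq.
rewrite sA -fsbig_seq// sumEFin lee_fin.
have [N sN] := seq_mdeg_bounded s'.
apply: le_trans (aM N).
apply: (@le_trans _ _ (\sum_(m <- s') `|a m| * rho ^+ mdeg m)).
  apply: ler_sum => m _; rewrite normrZ mulrC ler_wpM2l//.
  by rewrite monomial_le// ltW.
have -> : \sum_(m <- multis n N) `|a m| * rho ^+ mdeg m =
  \sum_(m <- s') `|a m| * rho ^+ mdeg m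
  + \sum_(m <- multis n N | m \notin s') `|a m| * rho ^+ mdeg m.
  rewrite (bigID (fun m => m \in s'))/=; congr (_ + _).
  rewrite -big_filter; apply: perm_big; apply: uniq_perm => //.
    by rewrite filter_uniq// multis_uniq.
  move=> m; rewrite mem_filter mem_multis andb_idr// => ms.
  exact: sN.
by rewrite lerDl sumr_ge0// => m _; rewrite mulr_ge0// exprn_ge0// ltW.
Qed.

Lemma pseries_cvg_unique x v : `|x| < rho -> pseries_cvg a x v -> v = pfun x.
Proof.
move=> xr [_ av]; have [_ af] := pseries_cvg_pfun xr.
exact: (cvg_unique _ av af).
Qed.

Let dsum_delta_cvg x h : `|x| <= rho / 8 ->
  cvg ((fun N => dsum N x h) @ \oo).
Proof.
move=> xr; pose s := rho / 8; have s0 : 0 < s by rewrite divr_gt0.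
have C0 : 0 <= `|h| / s by rewrite divr_ge0// ltW.
have q0 : 0 <= 4^-1 :> R by rewrite invr_ge0.
have q1 : 4^-1 < 1 :> R by rewrite invf_lt1// ltr1n.
apply: (dominated_cvg (ltW rho0) aM C0 q0 q1) => m.
have mh : `|mder m x h| <= `|h| / s * (4^-1 * rho) ^+ mdeg m.
  rewrite mulrAC ler_pdivlMr// mulrC.
  have := wder_le (mword m) h xr; rewrite size_mword -/s => dm.
  apply: le_trans dm _; rewrite [leRHS]mulrC ler_wpM2r//.
  apply: le_trans (nat_pow_le (mdeg m) (ltW s0)) _.
  by rewrite (_ : 2 * s = 4^-1 * rho) /s//; field.
rewrite normrZ [leRHS](_ : _ = `|h| / s * (4^-1 * rho) ^+ mdeg m * `|a m|).
  by rewrite ler_wpM2r.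
by rewrite exprMn; ring.
Qed.

Lemma dsum_cvg x h : `|x| <= rho / 8 ->
  (fun N => dsum N x h) @ \oo --> h *m pder x.
Proof.
move=> xr.
have -> : h *m pder x =
    \sum_i h 0 i *: lim ((fun N => dsum N x (delta_mx 0 i)) @ \oo).
  apply/rowP => j; rewrite mxE summxE; apply: eq_bigr => i _.
  by rewrite !mxE.
under eq_fun do rewrite dsum_sum.
apply: cvg_big => [|i _]; first exact: add_continuous.
by apply: cvgZl_tmp; exact: dsum_delta_cvg.
Qed.

(** Termwise, the second-order remainder carries a factor (mdeg m) ^ 2 <= 4 ^ mdeg m;
an eighth of the radius leaves room for it. *)
Lemma pfun_taylor1 x h : `|x| <= rho / 8 -> `|h + x| <= rho / 8 ->
  `|pfun (h + x) - pfun x - h *m pder x| <= M / (rho / 8) ^+ 2 * `|h| ^+ 2.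
Proof.
move=> xr hxs; pose s := rho / 8; have s0 : 0 < s by rewrite divr_gt0.
have q0 : 0 <= 8^-1 :> R by rewrite invr_ge0.
have q1 : 8^-1 < 1 :> R by rewrite invf_lt1// ltr1n.
have qs : 8^-1 * rho = s by rewrite mulrC.
have cv : (fun N => psum N (h + x) - psum N x - dsum N x h) @ \oo -->
   pfun (h + x) - pfun x - h *m pder x.
  apply: cvgB; last exact: dsum_cvg.
  by apply: cvgB; apply: (psum_cvg q0 q1); rewrite qs.
apply: cvg_norm_le cv _; apply: nearW => N.
rewrite /psum /dsum -!sumrB -/s.
rewrite mulrAC mulrC.
rewrite [leRHS](_ : _ = (`|h| ^+ 2 / s ^+ 2) * M); last by ring.
apply: (dominated_sum_le aM).
  by rewrite divr_ge0// exprn_ge0// ltW.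
move=> m; rewrite -!scalerBl normrZ mulrC mulrCA ler_wpM2l//.
have := @wmon_taylor1 _ _ (mword m) x h s xr hxs.
rewrite size_mword !wmon_mword => tm.
rewrite mulrAC ler_pdivlMr ?exprn_gt0// mulrC; apply: le_trans tm _.
rewrite mulrC ler_wpM2l ?exprn_ge0//.
apply: le_trans (nat2_pow_le _ (ltW s0)) _.
rewrite lerXn2r ?nnegrE ?mulr_ge0 ?(ltW s0) ?(ltW rho0)//.
by rewrite /s mulrCA ger_pMr// ler_pdivrMr// mul1r ler_nat.
Qed.

Hypothesis a0 : no_low_terms a.
Variable s : R.
Hypotheses (s0 : 0 < s) (s_rho : s <= rho / 8).

Let lip := 4 * s * M / rho ^+ 2.

Let low_order_dominated (t e : R) m : 0 <= e -> 0 <= t ->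
  s * t <= (mdeg m)%:R * s ^+ mdeg m * e ->
  t * `|a m| <= 4 * s * e / rho ^+ 2 * (`|a m| * rho ^+ mdeg m).
Proof.
move=> e0 t0 st; have [m2|m2] := ltnP (mdeg m) 2.
  by rewrite a0// normr0 mul0r !mulr0.
rewrite [leRHS]mulrCA mulrC ler_wpM2l//.
rewrite -(ler_pM2l s0); apply: le_trans st _.
apply: (@le_trans _ _ ((2 * s) ^+ mdeg m * e)).
  by rewrite ler_wpM2r// nat_pow_le// ltW.
rewrite [leRHS](_ : _ = (2 * s / rho) ^+ 2 * rho ^+ mdeg m * e); last first.
  by field; rewrite gt_eqF.
rewrite ler_wpM2r//.
have sr : 0 <= 2 * s / rho by rewrite divr_ge0 ?mulr_ge0// ltW.
rewrite -{1}(divfK (lt0r_neq0 rho0) (2 * s)) exprMn ler_wpM2r ?exprn_ge0 ?(ltW rho0)//.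
apply: ler_wiXn2l => //.
rewrite ler_pdivrMr// mul1r; apply: (@le_trans _ _ (2 * (rho / 8))).
  by rewrite ler_wpM2l.
by rewrite mulrCA ger_pMr// ler_pdivrMr// mul1r ler_nat.
Qed.

Let lip_dominated (e : R) (g : mindex n -> R) N : 0 <= e ->
  (forall m, s * `|g m| <= (mdeg m)%:R * s ^+ mdeg m * e) ->
  `|\sum_(m <- multis n N) g m *: a m| <= lip * e.
Proof.
move=> e0 ge; rewrite [leRHS](_ : _ = 4 * s * e / rho ^+ 2 * M); last by rewrite /lip; ring.
apply: (dominated_sum_le aM).
  by rewrite divr_ge0 ?mulr_ge0 ?exprn_ge0 ?(ltW s0) ?(ltW rho0).
by move=> m; rewrite normrZ; exact: low_order_dominated.
Qed.

(** Without terms of degree below 2 the Lipschitz constant is of the order of the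
radius s of the ball, hence small near the origin. *)
Lemma pfun_lipschitz x y : `|x| <= s -> `|y| <= s ->
  `|pfun x - pfun y| <= lip * `|x - y|.
Proof.
move=> xs ys.
have q0 : 0 <= 8^-1 :> R by rewrite invr_ge0.
have q1 : 8^-1 < 1 :> R by rewrite invf_lt1// ltr1n.
have cv : (fun N => psum N x - psum N y) @ \oo --> pfun x - pfun y.
  by apply: cvgB; apply: (psum_cvg q0 q1); rewrite mulrC; apply: le_trans s_rho.
apply: cvg_norm_le cv _; apply: nearW => N.
rewrite /psum -sumrB; under eq_bigr do rewrite -scalerBl.
apply: lip_dominated => // m.
by rewrite -!wmon_mword -size_mword wmon_lipschitz.
Qed.

Lemma pder_le x h : `|x| <= s -> `|h *m pder x| <= lip * `|h|.
Proof.
move=> xs; have cv := @dsum_cvg x h (le_trans xs s_rho).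
apply: cvg_norm_le cv _; apply: nearW => N.
apply: lip_dominated => // m.
by rewrite -size_mword wder_le.
Qed.

End PowerSeriesSum.

(** * Norm and order of polynomials *)

(** Lets polynomials with different supports be summed over a common list. *)
Lemma big_msupp (R : realType) (k : nat) (V : nmodType) (s : seq (multinom k))
    (p : mpoly k R) (F : multinom k -> V) :
  uniq s -> {subset msupp p <= s} ->
  (forall m, m \notin msupp p -> F m = 0) ->
  \sum_(m <- msupp p) F m = \sum_(m <- s) F m.
Proof.
move=> us ps F0; rewrite [RHS](bigID (mem (msupp p)))/= [X in _ + X]big1 ?addr0//.
rewrite -[RHS]big_filter; apply: perm_big; apply: uniq_perm => //.
  by rewrite filter_uniq.
by move=> m; rewrite mem_filter andb_idr// => /ps.
Qed.

Section PolynomialNorm.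
Variables (R : realType) (k : nat) (rho : R).
Hypothesis rho0 : 0 <= rho.
Local Notation P := (mpoly k R).
Local Notation deg := mpoly.mdeg.
Implicit Types (p q : P) (m : multinom k).

(** The weighted l1 norm: it is submultiplicative and bounds the values of the
polynomial on the ball of radius rho. *)
Definition pnorm p : R := \sum_(m <- msupp p) `|mcoeff m p| * rho ^+ deg m.

Let term_ge0 p m : 0 <= `|mcoeff m p| * rho ^+ deg m.
Proof. by rewrite mulr_ge0// exprn_ge0. Qed.

Lemma pnorm_ge0 p : 0 <= pnorm p.
Proof. by apply: sumr_ge0. Qed.

Lemma pnorm_seq (s : seq (multinom k)) p : uniq s -> {subset msupp p <= s} ->
  pnorm p = \sum_(m <- s) `|mcoeff m p| * rho ^+ deg m.
Proof.
move=> us ps; apply: big_msupp => // m /memN_msupp_eq0 ->.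
by rewrite normr0 mul0r.
Qed.

Lemma pnorm_le_coeff p q C : 0 <= C ->
  (forall m, `|mcoeff m p| <= C * `|mcoeff m q|) -> pnorm p <= C * pnorm q.
Proof.
move=> C0 pq; rewrite mulr_sumr.
rewrite (@pnorm_seq (msupp q)) ?msupp_uniq//; last first.
  move=> m; apply: contraLR => mq; rewrite -mcoeff_eq0 -normr_le0.
  by apply: le_trans (pq m) _; rewrite (memN_msupp_eq0 mq) normr0 mulr0.
apply: ler_sum => m _; rewrite mulrA ler_wpM2r ?exprn_ge0//.
Qed.

Lemma sum_coeff_le_pnorm (s : seq (multinom k)) p : uniq s ->
  \sum_(m <- s) `|mcoeff m p| * rho ^+ deg m <= pnorm p.
Proof.
move=> us; pose t := undup (s ++ msupp p).
rewrite (@pnorm_seq t) ?undup_uniq//; last first.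
  by move=> m pm; rewrite mem_undup mem_cat pm orbT.
rewrite [leRHS](bigID (mem s))/= -[leLHS]addr0 lerD ?sumr_ge0//.
rewrite -[leRHS]big_filter [leRHS](perm_big s)//; apply: uniq_perm => //.
  by rewrite filter_uniq// undup_uniq.
by move=> m; rewrite mem_filter mem_undup mem_cat; case: (m \in s).
Qed.

Lemma pnorm0 : pnorm 0 = 0.
Proof. by rewrite (@pnorm_seq [::]) ?big_nil// => m; rewrite msupp0. Qed.

Lemma pnormD p q : pnorm (p + q) <= pnorm p + pnorm q.
Proof.
pose s := undup (msupp p ++ msupp q).
have us : uniq s by exact: undup_uniq.
rewrite (@pnorm_seq s p)//; last by move=> m; rewrite mem_undup mem_cat => ->.
rewrite (@pnorm_seq s q)//; last first.
  by move=> m; rewrite mem_undup mem_cat orbC => ->.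
rewrite (@pnorm_seq s (p + q))//; last first.
  by move=> m /msuppD_le; rewrite mem_undup.
rewrite -big_split/=; apply: ler_sum => m _.
by rewrite mcoeffD -mulrDl ler_wpM2r ?exprn_ge0// ler_normD.
Qed.

Lemma pnorm_sum (I : Type) (r : seq I) (Q : pred I) (F : I -> P) :
  pnorm (\sum_(i <- r | Q i) F i) <= \sum_(i <- r | Q i) pnorm (F i).
Proof.
elim/big_rec2 : _ => [|i y x _ xy]; first by rewrite pnorm0.
by apply: le_trans (pnormD _ _) _; rewrite lerD2l.
Qed.

Lemma pnormZ (c : R) p : pnorm (c *: p) = `|c| * pnorm p.
Proof.
rewrite (@pnorm_seq (msupp p)) ?msupp_uniq//; last exact: msuppZ_le.
by rewrite mulr_sumr; apply: eq_bigr => m _; rewrite mcoeffZ normrM mulrA.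
Qed.

Lemma pnormX m : pnorm (mpolyX R m) = rho ^+ deg m.
Proof.
by rewrite /pnorm msuppX big_seq1 mcoeffX eqxx normr1 mul1r.
Qed.

Lemma pnormM p q : pnorm (p * q) <= pnorm p * pnorm q.
Proof.
rewrite {1}(mpolyE p) mulr_suml; apply: le_trans (pnorm_sum _ _ _) _.
rewrite mulr_suml; apply: ler_sum => m _.
rewrite -scalerAl pnormZ -mulrA ler_wpM2l//.
rewrite {1}(mpolyE q) mulr_sumr; apply: le_trans (pnorm_sum _ _ _) _.
rewrite mulr_sumr; apply: ler_sum => m' _.
by rewrite -scalerAr pnormZ -mpolyXD pnormX mdegD exprD mulrCA.
Qed.

Lemma pnorm1 : pnorm 1 = 1.
Proof. by rewrite -mpolyX0 pnormX mdeg0 expr0. Qed.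

Lemma pnorm_prod (I : Type) (w : seq I) (F : I -> P) C :
  0 <= C -> (forall i, pnorm (F i) <= C) ->
  pnorm (\prod_(i <- w) F i) <= C ^+ size w.
Proof.
move=> C0 FC; elim: w => [|i w IH]; first by rewrite big_nil pnorm1.
rewrite big_cons exprS; apply: le_trans (pnormM _ _) _.
by apply: ler_pM; rewrite ?pnorm_ge0.
Qed.

End PolynomialNorm.

Section PolynomialOrder.
Variables (R : realType) (k : nat).
Local Notation P := (mpoly k R).
Local Notation deg := mpoly.mdeg.
Implicit Types (p q : P) (m : multinom k).

(** The filtration by the order of vanishing at the origin. *)
Definition order_ge a p := forall m, (deg m < a)%N -> mcoeff m p = 0.

Lemma order_ge_le a b p : (a <= b)%N -> order_ge b p -> order_ge a p.
Proof. by move=> ab pb m ma; apply: pb; exact: leq_trans ab. Qed.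

Lemma order_ge0 a : order_ge a 0.
Proof. by move=> m _; rewrite mcoeff0. Qed.

Lemma order_geD a p q : order_ge a p -> order_ge a q -> order_ge a (p + q).
Proof. by move=> pa qa m ma; rewrite mcoeffD pa// qa// addr0. Qed.

Lemma order_geZ a (c : R) p : order_ge a p -> order_ge a (c *: p).
Proof. by move=> pa m ma; rewrite mcoeffZ pa// mulr0. Qed.

Lemma order_ge_sum a (I : eqType) (r : seq I) (F : I -> P) :
  (forall i, i \in r -> order_ge a (F i)) -> order_ge a (\sum_(i <- r) F i).
Proof.
move=> Fa; rewrite big_seq; elim/big_rec : _ => [|i x ir xa].
  exact: order_ge0.
by apply: order_geD => //; exact: Fa.
Qed.

Lemma order_geM a b p q : order_ge a p -> order_ge b q ->
  order_ge (a + b) (p * q).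
Proof.
move=> pa qb m ma; rewrite mcoeffM big1// => -[m1 m2] /eqP/= mE.
have [m1a|m1a] := ltnP (deg m1) a; first by rewrite pa// mul0r.
have [m2b|m2b] := ltnP (deg m2) b; first by rewrite (qb m2)// mulr0.
have degm : deg m = (deg m1 + deg m2)%N by rewrite -mdegD -mE.
by have := leq_add m1a m2b; rewrite -degm leqNgt ma.
Qed.

Lemma order_geX m : order_ge (deg m) (mpolyX R m).
Proof. by move=> m' mm; rewrite mcoeffX; case: eqP mm => // ->; rewrite ltnn. Qed.

Lemma order_ge_prod (I : Type) (w : seq I) (F : I -> P) :
  (forall i, order_ge 1 (F i)) -> order_ge (size w) (\prod_(i <- w) F i).
Proof.
move=> F1; elim: w => [|i w IH] //=; rewrite big_cons -add1n.
by apply: order_geM.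
Qed.

(** Replacing the factors one at a time, each replacement contributes the order of
the difference, and the other size w - 1 factors contribute one each. *)
Lemma order_ge_prodB (I : Type) (w : seq I) (F G : I -> P) a :
  (forall i, order_ge 1 (F i)) -> (forall i, order_ge 1 (G i)) ->
  (forall i, order_ge a.+1 (F i - G i)) ->
  order_ge (a + size w) (\prod_(i <- w) F i - \prod_(i <- w) G i).
Proof.
move=> F1 G1 FG; elim: w => [|i w IH] /=.
  by rewrite !big_nil subrr; exact: order_ge0.
rewrite !big_cons.
have -> : F i * \prod_(j <- w) F j - G i * \prod_(j <- w) G j =
  F i * (\prod_(j <- w) F j - \prod_(j <- w) G j)
  + (F i - G i) * \prod_(j <- w) G j by ring.
apply: order_geD.
  by rewrite addnS -add1n; apply: order_geM.
by rewrite addnS -addSn; apply: order_geM => //; exact: order_ge_prod.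
Qed.

(** On half the radius, a polynomial of order a gains the factor 2^-a over its
norm. *)
Lemma meval_le (rho : R) p a (v : 'I_k -> R) : 0 <= rho ->
  (forall i, `|v i| <= rho / 2) -> order_ge a p ->
  `|meval v p| <= 2^-1 ^+ a * pnorm rho p.
Proof.
move=> rho0 vrho pa; rewrite mevalE.
apply: le_trans (ler_norm_sum _ _ _) _.
rewrite mulr_sumr; apply: ler_sum => m _; rewrite normrM.
have [ma|ma] := ltnP (deg m) a; first by rewrite pa// normr0 !mul0r mulr0.
rewrite [leRHS]mulrCA ler_wpM2l//.
apply: (@le_trans _ _ ((rho / 2) ^+ deg m)).
  rewrite normr_prod mdegE -prodrXr; apply: ler_prod => i _.
  by rewrite normr_ge0 normrX lerXn2r// nnegrE divr_ge0.
rewrite exprMn mulrC ler_wpM2r ?exprn_ge0//.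
by apply: ler_wiXn2l => //; rewrite invf_le1// ler1n.
Qed.

End PolynomialOrder.

(** * The formal solution of the invariance equation *)

Section Embedding.
Variables (R : realType) (k d : nat) (pos : 'I_d -> option 'I_k).

(** The coordinate subspace whose i-th coordinate is carried by the j with
pos j = Some i.  Keeping pos abstract treats the stable and unstable subspaces
alike. *)
Definition emb (x : 'rV[R]_k) : 'rV[R]_d :=
  \row_j (if pos j is Some i then x 0 i else 0).

Lemma emb_norm_le x : `|emb x| <= `|x|.
Proof.
apply: norm_le_coord => // j; rewrite mxE.
by case: (pos j) => [i|]; rewrite ?norm_coord// normr0.
Qed.

End Embedding.

Section FormalSolution.
Variables (R : realType) (k d : nat) (pos : 'I_d -> option 'I_k).
Variables (lam : 'rV[R]_k) (l : 'rV[R]_d) (c : mindex d -> 'rV[R]_d).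
Variables (rho gam : R).
Local Notation P := (mpoly k R).
Local Notation deg := mpoly.mdeg.
Implicit Types (p q : P).

Definition to_multinom (m : mindex k) : multinom k := Multinom [tuple m i | i < k].
Definition of_multinom (m : multinom k) : mindex k := [ffun i => m i].

Definition linear_part (j : 'I_d) : P :=
  if pos j is Some i then mpolyX R (mnm1 i) else 0.

Definition compose N (Z : 'I_d -> P) (i : 'I_d) : P :=
  \sum_(m <- multis d N) c m 0 i *: \prod_(j <- mword m) Z j.

Definition divisor (m : mindex k) (i : 'I_d) : R := mdot m lam - l 0 i.

(** Inverts the operator p |-> D p (lam x) - l_i p on the monomials of degree at
most N.  On degrees below 2, where the divisor may vanish, it is only applied
to polynomials without such terms. *)
Definition solve_linear N (i : 'I_d) q : P :=
  \sum_(m <- msupp q | (deg m <= N)%N)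
     (mcoeff m q / divisor (of_multinom m) i) *: mpolyX R m.

(** Step N solves the linear equation for the composition of F with the previous
step, truncated to degree N so as to remain a polynomial. *)
Fixpoint approx_sol N : 'I_d -> P :=
  if N is N'.+1 then
    fun i => solve_linear N i
      (compose N (fun j => linear_part j + approx_sol N' j) i)
  else fun=> 0.

Definition approx_param N j := linear_part j + approx_sol N j.

(** The coefficients of degree N no longer change after step N. *)
Definition alpha_of (m : mindex k) : 'rV[R]_d :=
  \row_i mcoeff (to_multinom m) (approx_sol (mdeg m) i).

Lemma to_multinomK : cancel to_multinom of_multinom.
Proof. by move=> m; apply/ffunP => i; rewrite ffunE /to_multinom mnmE. Qed.

Lemma of_multinomK : cancel of_multinom to_multinom.
Proof. by move=> m; apply/mnmP => i; rewrite /to_multinom mnmE ffunE. Qed.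

Lemma deg_to_multinom (m : mindex k) : deg (to_multinom m) = mdeg m.
Proof. by rewrite mdegE; apply: eq_bigr => i _; rewrite /to_multinom mnmE. Qed.

Lemma mdeg_of_multinom m : mdeg (of_multinom m) = deg m.
Proof. by rewrite -deg_to_multinom of_multinomK. Qed.

Let multis_multinom N := [seq to_multinom m | m <- multis k N].

Let multis_multinom_uniq N : uniq (multis_multinom N).
Proof. by rewrite map_inj_uniq ?multis_uniq//; exact: can_inj to_multinomK. Qed.

Lemma meval_bounded_degree N p (x : 'rV[R]_k) :
  (forall m, (N < deg m)%N -> mcoeff m p = 0) ->
  meval (x 0) p =
  \sum_(m <- multis k N) mcoeff (to_multinom m) p * monomial m x.
Proof.
move=> pN; rewrite mevalE (@big_msupp _ _ _ (multis_multinom N))//.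
- rewrite big_map; apply: eq_bigr => m _; congr (_ * _).
  by apply: eq_bigr => i _; rewrite /to_multinom mnmE.
- move=> m pm; apply/mapP; exists (of_multinom m); rewrite ?of_multinomK//.
  rewrite mem_multis mdeg_of_multinom leqNgt; apply: contraL pm => mN.
  by rewrite -mcoeff_eq0 pN.
- by move=> m /memN_msupp_eq0 ->; rewrite mul0r.
Qed.

Lemma mcoeff_solve_linear N i q m :
  mcoeff m (solve_linear N i q) =
  if (deg m <= N)%N then mcoeff m q / divisor (of_multinom m) i else 0.
Proof.
rewrite /solve_linear raddf_sum/=.
under eq_bigr do rewrite mcoeffZ mcoeffX.
have [mq|mq] := boolP (m \in msupp q); last first.
  rewrite (memN_msupp_eq0 mq) mul0r if_same big1_seq// => m' /andP[_ m'q].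
  by case: eqP mq => [<-|]; rewrite ?m'q// mulr0.
have [mN|mN] := leqP (deg m) N; last first.
  rewrite big1// => m' m'N.
  by case: eqP mN => [<-|]; rewrite ?mulr0// ltnNge m'N.
rewrite -big_filter (bigD1_seq m)/= ?mem_filter ?mN//; last first.
  by rewrite filter_uniq.
rewrite eqxx mulr1 big1 ?addr0// => m' mm'.
by rewrite (negbTE mm') mulr0.
Qed.

Lemma order_linear_part j : order_ge 1 (linear_part j).
Proof.
rewrite /linear_part; case: (pos j) => [i|]; last exact: order_ge0.
by rewrite -(mdeg1 i); exact: order_geX.
Qed.

Lemma order_solve_linear a N i q : order_ge a q -> order_ge a (solve_linear N i q).
Proof. by move=> qa m ma; rewrite mcoeff_solve_linear qa// mul0r if_same. Qed.

Hypothesis c0 : no_low_terms c.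

Lemma order_compose N Z i : (forall j, order_ge 1 (Z j)) ->
  order_ge 2 (compose N Z i).
Proof.
move=> Z1; apply: order_ge_sum => m _.
have [m2|m2] := ltnP (mdeg m) 2.
  by rewrite c0// mxE scale0r; exact: order_ge0.
apply/order_geZ/(order_ge_le m2); rewrite -size_mword.
exact: order_ge_prod.
Qed.

Lemma order_approx_sol N i : order_ge 2 (approx_sol N i).
Proof.
elim: N i => [|N IH] i /=; first exact: order_ge0.
apply/order_solve_linear/order_compose => j.
by apply: order_geD; [exact: order_linear_part|exact: order_ge_le (IH j)].
Qed.

Lemma order_approx_param N j : order_ge 1 (approx_param N j).
Proof.
apply: order_geD; first exact: order_linear_part.
exact: order_ge_le (order_approx_sol N j).
Qed.

(** One step gains one degree: F has no linear part, so its composition with two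
maps that agree up to degree N agrees up to degree N.+1. *)
Lemma approx_sol_agree N i : order_ge N.+1 (approx_sol N.+1 i - approx_sol N i).
Proof.
elim: N i => [|N IH] i.
  rewrite subr0; exact: order_ge_le (order_approx_sol 1 i).
move=> m; rewrite ltnS => mN.
rewrite mcoeffB [in approx_sol N.+2 i]/= [in approx_sol N.+1 i]/=.
rewrite !mcoeff_solve_linear mN (leq_trans mN)// -mulrBl.
rewrite -mcoeffB (_ : mcoeff m _ = 0) ?mul0r//.
suff : order_ge N.+2 (compose N.+2 (approx_param N.+1) i
                      - compose N.+1 (approx_param N) i) by apply.
rewrite /compose (big_multis_split _ (leqnSn N.+1)) addrAC -sumrB.
apply: order_geD.
  apply: order_ge_sum => m' _; rewrite -scalerBr.
  have [m2|m2] := ltnP (mdeg m') 2.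
    by rewrite c0// mxE scale0r; exact: order_ge0.
  apply: order_geZ; apply: (@order_ge_le _ _ _ (N + size (mword m'))).
    by rewrite size_mword -addn2 leq_add2l.
  apply: order_ge_prodB; [exact: order_approx_param|exact: order_approx_param|].
  move=> j; rewrite /approx_param opprD addrACA subrr add0r; exact: IH.
rewrite -big_filter; apply: order_ge_sum => m'.
rewrite mem_filter => /andP[Nm' _]; apply: order_geZ.
apply: (order_ge_le Nm'); rewrite -size_mword.
by apply: order_ge_prod; exact: order_approx_param.
Qed.

Lemma approx_sol_stable K N i m : (deg m <= K <= N)%N ->
  mcoeff m (approx_sol N i) = mcoeff m (approx_sol K i).
Proof.
move=> /andP[mK]; elim: N => [|N IH]; first by rewrite leqn0 => /eqP ->.
rewrite leq_eqVlt => /predU1P[->//|]; rewrite ltnS => KN.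
rewrite -(IH KN); apply/eqP; rewrite -subr_eq0 -mcoeffB; apply/eqP.
by apply: approx_sol_agree; rewrite ltnS (leq_trans mK).
Qed.

Lemma approx_sol_deg N i m : (N < deg m)%N -> mcoeff m (approx_sol N i) = 0.
Proof.
case: N => [|N] mN /=; first by rewrite mcoeff0.
by rewrite mcoeff_solve_linear leqNgt mN.
Qed.

Lemma alpha_coeff N (m : mindex k) i : (mdeg m <= N)%N ->
  alpha_of m 0 i = mcoeff (to_multinom m) (approx_sol N i).
Proof.
by move=> mN; rewrite mxE (@approx_sol_stable (mdeg m) N)// deg_to_multinom leqnn.
Qed.

Lemma alpha_no_low : no_low_terms alpha_of.
Proof.
move=> m m2; apply/rowP => i; rewrite !mxE.
by apply: order_approx_sol; rewrite deg_to_multinom.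
Qed.

Lemma psum_alpha N (x : 'rV[R]_k) i :
  psum alpha_of N x 0 i = meval (x 0) (approx_sol N i).
Proof.
rewrite (@meval_bounded_degree N); last by move=> m; exact: approx_sol_deg.
rewrite /psum summxE big_seq [RHS]big_seq; apply: eq_bigr => m.
by rewrite mem_multis mxE => mN; rewrite (alpha_coeff _ mN) mulrC.
Qed.

Lemma meval_linear_part (x : 'rV[R]_k) j :
  meval (x 0) (linear_part j) = emb pos x 0 j.
Proof.
rewrite /linear_part mxE; case: (pos j) => [i|]; last exact: meval0.
exact: mevalXU.
Qed.

Lemma meval_compose N (Z : 'I_d -> P) (x : 'rV[R]_k) i :
  meval (x 0) (compose N Z i) = psum c N (\row_j meval (x 0) (Z j)) 0 i.
Proof.
rewrite /compose raddf_sum summxE; apply: eq_bigr => m _ /=.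
rewrite mevalZ mxE mulrC; congr (_ * _).
rewrite rmorph_prod -wmon_mword; apply: eq_bigr => j _.
by rewrite mxE.
Qed.

Hypotheses (rho0 : 0 < rho) (gam0 : 0 < gam).
Hypothesis divisor_ge : forall (m : mindex k) i,
  (2 <= mdeg m)%N -> gam <= `|divisor m i|.
Let bound := gam * rho / d%:R.
Hypothesis c_bound : coef_sum_le c (2 * rho) bound.

Lemma pnorm_compose N (Z : 'I_d -> P) i :
  (forall j, pnorm rho (Z j) <= 2 * rho) -> pnorm rho (compose N Z i) <= bound.
Proof.
move=> Zle; apply: le_trans (pnorm_sum _ _ _ _) _; first exact: ltW.
apply: le_trans (c_bound N); apply: ler_sum => m _.
rewrite pnormZ; apply: ler_pM => //.
- by rewrite pnorm_ge0// ltW.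
- exact: norm_coord.
- by rewrite -size_mword; apply: pnorm_prod => //; rewrite ?mulr_ge0// ltW.
Qed.

Lemma pnorm_solve_linear N i q : order_ge 2 q ->
  pnorm rho (solve_linear N i q) <= gam^-1 * pnorm rho q.
Proof.
move=> q2; apply: pnorm_le_coeff; [exact: ltW|by rewrite invr_ge0 ltW|].
move=> m; rewrite mcoeff_solve_linear.
have [m2|m2] := ltnP (deg m) 2.
  by rewrite q2// mul0r if_same normr0 mulr0.
case: ifP => _; last by rewrite normr0 mulr_ge0// invr_ge0 ltW.
rewrite normrM mulrC ler_wpM2r// normfV lef_pV2 ?posrE//.
  by rewrite divisor_ge ?mdeg_of_multinom.
by apply: (lt_le_trans gam0); rewrite divisor_ge ?mdeg_of_multinom.
Qed.

Lemma pnorm_linear_part j : pnorm rho (linear_part j) <= rho.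
Proof.
rewrite /linear_part; case: (pos j) => [i|]; last by rewrite pnorm0 ltW.
by rewrite pnormX mdeg1 expr1.
Qed.

Let pnorm_param_of_sum N : \sum_i pnorm rho (approx_sol N i) <= rho ->
  forall j, pnorm rho (approx_param N j) <= 2 * rho.
Proof.
move=> sN j; apply: le_trans (pnormD (ltW rho0) _ _) _.
rewrite mulr2n mulrDl mul1r lerD ?pnorm_linear_part//.
apply: le_trans sN; rewrite (bigD1 j)//= lerDl sumr_ge0// => i _.
by rewrite pnorm_ge0// ltW.
Qed.

(** The ball of radius rho is stable under the iteration: each of the d components
of the composition has norm at most bound = gam * rho / d, and solving the
linear equation costs a factor gam^-1. *)
Lemma sum_pnorm_approx_sol N : \sum_i pnorm rho (approx_sol N i) <= rho.
Proof.
elim: N => [|N IH] /=.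
  by rewrite big1 ?ltW// => i _; rewrite pnorm0.
apply: (@le_trans _ _ (\sum_(i < d) gam^-1 * bound)).
  apply: ler_sum => i _.
  apply: le_trans (pnorm_solve_linear _ _ _) _.
    exact: order_compose (order_approx_param N).
  rewrite ler_wpM2l ?invr_ge0 ?(ltW gam0)//.
  by apply: pnorm_compose; exact: pnorm_param_of_sum.
rewrite sumr_const card_ord -mulr_natr /bound.
have [->|dn0] := eqVneq d 0%N; first by rewrite mulr0 ltW.
rewrite -mulrA divfK ?pnatr_eq0// mulKf ?gt_eqF//.
Qed.

Lemma pnorm_approx_param N j : pnorm rho (approx_param N j) <= 2 * rho.
Proof. exact: pnorm_param_of_sum (sum_pnorm_approx_sol N) j. Qed.

Lemma alpha_coef_sum : coef_sum_le alpha_of rho rho.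
Proof.
move=> N; apply: le_trans (sum_pnorm_approx_sol N).
apply: (@le_trans _ _ (\sum_i \sum_(m <- multis k N)
    `|mcoeff (to_multinom m) (approx_sol N i)| * rho ^+ mdeg m)).
  rewrite exchange_big/= big_seq [leRHS]big_seq; apply: ler_sum => m.
  rewrite mem_multis => mN; rewrite -mulr_suml ler_wpM2r ?exprn_ge0 ?(ltW rho0)//.
  apply: le_trans (norm_le_sum _) _; apply: ler_sum => i _.
  by rewrite (alpha_coeff _ mN).
apply: ler_sum => i _.
apply: le_trans (sum_coeff_le_pnorm (ltW rho0) _ (multis_multinom_uniq N)).
by rewrite big_map; apply: ler_sum => m _; rewrite deg_to_multinom.
Qed.

(** The truncated equation holds up to a polynomial of order N.+2 whose norm does
not depend on N. *)
Lemma formal_invariance N (x : 'rV[R]_k) i : `|x| <= rho / 2 ->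
  `|psum c N.+1 (emb pos x + psum alpha_of N x) 0 i -
    \sum_(m <- multis k N.+1) divisor m i * monomial m x * alpha_of m 0 i|
  <= 2^-1 ^+ N.+2 * bound.
Proof.
move=> xr; set q := compose N.+1 (approx_param N) i.
have -> : psum c N.+1 (emb pos x + psum alpha_of N x) 0 i = meval (x 0) q.
  rewrite /q meval_compose; congr (psum _ _ _ 0 i); apply/rowP => j.
  by rewrite mxE psum_alpha -meval_linear_part mxE mevalD.
have q2 : order_ge 2 q by exact: order_compose (order_approx_param N).
(* The part of q that the next iterate solves for exactly. *)
pose r : P := \sum_(m <- multis k N.+1) mcoeff (to_multinom m) q *:
                 mpolyX R (to_multinom m).
have rE m : mcoeff m r = if (deg m <= N.+1)%N then mcoeff m q else 0.
  rewrite /r raddf_sum/=; under eq_bigr do rewrite mcoeffZ mcoeffX.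
  have [mN|mN] := leqP (deg m) N.+1; last first.
    rewrite big1_seq// => m'; rewrite mem_multis => /andP[_ m'N].
    case: eqP mN => [<-|]; rewrite ?mulr0// deg_to_multinom ltnNge.
    by rewrite m'N.
  rewrite (bigD1_seq (of_multinom m)) ?multis_uniq ?mem_multis ?mdeg_of_multinom//=.
  rewrite of_multinomK eqxx mulr1 big1 ?addr0// => m' mm'.
  rewrite (_ : (to_multinom m' == m) = false) ?mulr0//.
  by apply: contraNF mm' => /eqP <-; rewrite to_multinomK.
have -> : \sum_(m <- multis k N.+1) divisor m i * monomial m x * alpha_of m 0 i
    = meval (x 0) r.
  rewrite (@meval_bounded_degree N.+1); last first.
    by move=> m mN; rewrite rE leqNgt mN.
  rewrite big_seq [RHS]big_seq; apply: eq_bigr => m; rewrite mem_multis => mN.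
  rewrite rE deg_to_multinom mN (alpha_coeff _ mN)/= mcoeff_solve_linear.
  rewrite deg_to_multinom mN to_multinomK mulrAC -/q; congr (_ * _).
  rewrite mulrC.
  have [m2|m2] := ltnP (mdeg m) 2.
    by rewrite q2 ?deg_to_multinom// !mul0r.
  rewrite divfK// -normr_gt0; apply: lt_le_trans gam0 _.
  exact: divisor_ge.
rewrite -mevalB; apply: le_trans (_ : 2^-1 ^+ N.+2 * pnorm rho (q - r) <= _).
  apply: meval_le; [exact: ltW| |].
    by move=> j; apply: le_trans (norm_coord x j) xr.
  move=> m; rewrite ltnS => mN.
  by rewrite mcoeffB rE mN subrr.
rewrite ler_wpM2l ?exprn_ge0 ?invr_ge0//.
apply: (@le_trans _ _ (1 * pnorm rho q)).
  apply: pnorm_le_coeff; [exact: ltW|exact: ler01|].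
  move=> m; rewrite mcoeffB rE mul1r.
  by case: ifP => _; rewrite ?subr0// subrr normr0.
by rewrite mul1r; apply: pnorm_compose; exact: pnorm_approx_param.
Qed.

End FormalSolution.

(** * Curves in coordinates, fixed points and linear flows *)

Section CoordinateCalculus.
Variables (R : realType) (d : nat).

Lemma nbhs0_rowP (A : set 'rV[R]_d) :
  nbhs (0 : 'rV[R]_d) A <-> exists2 e : R, 0 < e & forall z, `|z| < e -> A z.
Proof.
split=> [/nbhs_ballP[e /= e0 eA]|[e e0 eA]].
  by exists e => // z ze; apply: eA; rewrite -ball_normE /= sub0r normrN.
apply/nbhs_ballP; exists e => //= z.
by rewrite -ball_normE /= sub0r normrN; exact: eA.
Qed.

Lemma cvg_coord (u : nat -> 'rV[R]_d) (v : 'rV[R]_d) i :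
  u @ \oo --> v -> (fun N => u N 0 i) @ \oo --> v 0 i.
Proof.
move=> uv; apply/cvgrPdist_le => e e0; near=> N.
have -> : v 0 i - u N 0 i = (v - u N) 0 i by rewrite !mxE.
apply: le_trans (norm_coord _ _) _.
by near: N; move/cvgrPdist_le : uv; exact.
Unshelve. all: by end_near. Qed.

Lemma is_derive_coord (V : normedModType R) (u : V -> 'rV[R]_d) t v du j :
  is_derive t v u du -> is_derive t v (fun s => u s 0 j) (du 0 j).
Proof.
move=> [du1 <-]; apply: DeriveDef; first exact: ((derivable_mxP _ _ _).1 du1).
by rewrite derive_mx// mxE.
Qed.

Lemma is_derive_row (V : normedModType R) (u : V -> 'rV[R]_d) t v (du : 'rV[R]_d) :
  (forall j, is_derive t v (fun s => u s 0 j) (du 0 j)) -> is_derive t v u du.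
Proof.
move=> uj; have du1 : derivable u t v.
  by apply/derivable_mxP => i j; rewrite ord1; exact: ex_derive.
apply: DeriveDef => //; rewrite derive_mx//; apply/rowP => j.
by rewrite mxE; exact: derive_val.
Qed.

Lemma derive_ge0_le (f df : R -> R) (T : R) : 0 <= T ->
  (forall t : R, 0 <= t -> is_derive t 1 f (df t)) ->
  (forall t, 0 <= t -> 0 <= df t) -> f 0 <= f T.
Proof.
move=> T0 fd df0; have [] := @MVT_segment R f df 0 T T0.
- by move=> t; rewrite in_itv/= => /andP[/ltW t0 _]; exact: fd.
- apply: derivable_within_continuous => t; rewrite in_itv/= => /andP[t0 _].
  by have ? := fd _ t0; exact: ex_derive.
- move=> t; rewrite in_itv/= => /andP[t0 _] fE.
  by rewrite -subr_ge0 fE subr0 mulr_ge0// df0.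
Qed.

Lemma half_contraction_fixpoint (f : 'rV[R]_d -> 'rV[R]_d) e : 0 <= e ->
  (forall x, `|x| <= e -> `|f x| <= e) ->
  (forall x y, `|x| <= e -> `|y| <= e -> `|f x - f y| <= 2^-1 * `|x - y|) ->
  exists2 x, `|x| <= e & x = f x.
Proof.
move=> e0 fe flip; pose U := [set x : 'rV[R]_d | `|x| <= e].
have fU : set_fun U U f by move=> x; exact: fe.
pose fM := isFun.Build _ _ _ _ _ fU.
pose g : {fun U >-> U} := HB.pack f fM.
have gc : is_contraction g.
  have h0 : 0 <= 2^-1 :> R by rewrite invr_ge0.
  exists (NngNum h0); split => /=; first by rewrite invf_lt1// ltr1n.
  by move=> [x y] [/= Ux Uy]; exact: flip.
have Ucl : closed U.
  apply: (@closed_comp _ _ (fun x : 'rV[R]_d => `|x|) [set x | x <= e]).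
    by move=> x _; exact: norm_continuous.
  exact: closed_le.
have [|x Ux xE] := banach_fixed_point gc Ucl; last by exists x.
by exists 0; rewrite /U /= normr0.
Qed.

End CoordinateCalculus.

Section LinearFlow.
Variables (R : realType) (k : nat) (lam : 'rV[R]_k) (gam : R).
Hypotheses (gam0 : 0 < gam) (lam_le : forall i, lam 0 i <= - gam).

Definition linflow (x : 'rV[R]_k) (t : R) : 'rV[R]_k :=
  \row_i (x 0 i * expR (lam 0 i * t)).

Lemma linflow0 x : linflow x 0 = x.
Proof. by apply/rowP => i; rewrite mxE mulr0 expR0 mulr1. Qed.

Lemma is_derive_linflow x (t : R) :
  is_derive t 1 (linflow x) (linflow x t *m diag_mx lam).
Proof.
apply: is_derive_row => i.
rewrite (_ : (fun s => linflow x s 0 i) =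
             (x 0 i) \*: (expR \o (lam 0 i \*: (id : R -> R)))); last first.
  by apply/funext => s; rewrite mxE.
have lin : is_derive t 1 (lam 0 i \*: (id : R -> R)) (lam 0 i).
  by apply: is_derive_eq; rewrite /GRing.scale /= mulr1.
have D := @is_deriveZ _ _ _ _ (x 0 i) t 1 _
  (@is_derive1_comp R expR _ t _ _ (is_derive_expR _) lin).
rewrite (_ : (_ *m _) 0 i = x 0 i *: (expR (lam 0 i * t) * lam 0 i)) //.
by rewrite mul_mx_diag !mxE -mulrA.
Qed.

Lemma linflow_le x (t : R) : 0 <= t -> `|linflow x t| <= expR (- (t * gam)) * `|x|.
Proof.
move=> t0; apply: norm_le_coord => [|i]; first by rewrite mulr_ge0// expR_ge0.
rewrite mxE normrM mulrC ler_pM ?norm_coord//.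
rewrite ger0_norm ?expR_ge0// ler_expR mulrC -mulrN ler_wpM2l//.
Qed.

Lemma linflow_norm_le x (t : R) : 0 <= t -> `|linflow x t| <= `|x|.
Proof.
move=> t0; apply: le_trans (linflow_le x t0) _.
rewrite ler_piMl// expR_le1 oppr_le0 mulr_ge0// ltW//.
Qed.

Lemma linflow_cvg0 x : linflow x t @[t --> +oo] --> (0 : 'rV[R]_k).
Proof.
apply/cvgr0Pnorm_le => e e0.
have tg : (fun t : R => expR (- (t * gam)) * `|x|) t @[t --> +oo] --> (0 : R).
  rewrite -[X in _ --> X](mul0r `|x|); apply: cvgM; last exact: cvg_cst.
  apply: (@cvg_comp _ _ _ (fun t => t * gam) (fun t => expR (- t)) _ +oo); last exact: cvgr_expR.
  exact: gt0_cvgMly.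
near=> t; apply: le_trans (linflow_le _ _) _.
  by near: t; apply: nbhs_pinfty_ge; exact: num_real.
apply: le_trans (ler_norm _) _.
by near: t; move/cvgr0Pnorm_le : tg; exact.
Unshelve. all: by end_near. Qed.

End LinearFlow.

(** * The local stable manifold *)

Section SmallSeries.
Variables (R : realType) (n d : nat) (a : mindex n -> 'rV[R]_d) (rho M : R).
Hypotheses (rho0 : 0 < rho) (a0 : no_low_terms a) (aM : coef_sum_le a rho M).

(** Each term has degree at least 2, hence carries at least one factor q. *)
Lemma psum_le N x q : 0 <= q -> q <= 1 -> `|x| <= q * rho ->
  `|psum a N x| <= q * M.
Proof.
move=> q0 q1 xq; apply: (dominated_sum_le aM) => // m.
have [m2|m2] := ltnP (mdeg m) 2; first by rewrite a0// scaler0 !normr0 mul0r mulr0.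
rewrite normrZ [leRHS]mulrCA mulrC ler_wpM2l//.
apply: le_trans (monomial_le m xq) _; rewrite exprMn.
rewrite ler_wpM2r ?exprn_ge0 ?(ltW rho0)//.
rewrite -[leRHS]expr1; apply: ler_wiXn2l => //; exact: ltnW.
Qed.

Lemma pfun_le x q : 0 <= q -> q < 1 -> `|x| <= q * rho ->
  `|pfun a x| <= q * M.
Proof.
move=> q0 q1 xq; have cv := psum_cvg rho0 aM q0 q1 xq.
by apply: cvg_norm_le cv _; apply: nearW => N; apply: psum_le => //; exact: ltW.
Qed.

Lemma pfun0 : pfun a 0 = 0.
Proof.
apply/eqP; rewrite -normr_le0; have := @pfun_le 0 0.
by rewrite mul0r normr0 mul0r; apply.
Qed.

Lemma taylor_part_psum N x : taylor_part a N x = psum a N x.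
Proof.
rewrite /taylor_part -psum_fsbig; apply: fsbig_widen.
  by move=> m /= /andP[].
move=> m [/= mN /negP]; rewrite mN andbT -ltnNge => m2.
by rewrite /= a0// scaler0.
Qed.

End SmallSeries.

Lemma norm_cvg_squeeze (R : realType) (V : normedModType R) (u : nat -> V) (v : V)
    (e : nat -> R) :
  (forall N, `|u N - v| <= e N) -> e @ \oo --> (0 : R) -> u @ \oo --> v.
Proof.
move=> ue e0; apply/cvgrPdist_le => eps eps0; near=> N.
rewrite distrC; apply: le_trans (ue N) _; apply: le_trans (ler_norm _) _.
by near: N; move/cvgr0Pnorm_le : e0; exact.
Unshelve. all: by end_near. Qed.

Section StableManifold.
Variables (R : realType) (k d : nat).
Variables (pos : 'I_d -> option 'I_k) (idx : 'I_k -> 'I_d).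
Hypothesis posE : forall j i, (pos j == Some i) = (idx i == j).
Variables (l : 'rV[R]_d) (c : mindex d -> 'rV[R]_d) (F : 'rV[R]_d -> 'rV[R]_d).
Variables (rho gam : R).
Let lam : 'rV[R]_k := \row_i l 0 (idx i).
Hypotheses (rho0 : 0 < rho) (gam0 : 0 < gam).
Hypothesis l_stable : forall i, l 0 (idx i) <= - gam.
Hypothesis l_unstable : forall j, pos j = None -> gam <= l 0 j.
Hypothesis divisor_ge : forall (m : mindex k) i,
  (2 <= mdeg m)%N -> gam <= `|divisor lam l m i|.
Hypotheses (c0 : no_low_terms c) (cF : analytic_at_origin c F).
Hypothesis c_bound : coef_sum_le c (2 * rho) (gam * rho / d%:R).

Let alpha := alpha_of pos lam l c.
Let phi := pfun alpha.
Let X := vfield (diag_mx l) F.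
Let P x := emb pos x + phi x.

Let alpha0 : no_low_terms alpha := alpha_no_low pos lam l c0.

Let alphaM : coef_sum_le alpha rho rho :=
  alpha_coef_sum pos c0 rho0 gam0 divisor_ge c_bound.

Let pos_idx i : pos (idx i) = Some i.
Proof. by apply/eqP; rewrite posE. Qed.

Let rho20 : 0 < 2 * rho.
Proof. by rewrite mulr_gt0. Qed.

Lemma phi_le x : `|x| < rho -> `|phi x| <= `|x|.
Proof.
move=> xr; have q0 : 0 <= `|x| / rho by rewrite divr_ge0// ltW.
have := @pfun_le _ _ _ _ _ _ rho0 alpha0 alphaM x (`|x| / rho) q0.
by rewrite divfK ?gt_eqF// ltr_pdivrMr// mul1r; apply.
Qed.

Lemma P_le x : `|x| < rho -> `|P x| <= 2 * `|x|.
Proof.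
move=> xr; apply: le_trans (ler_normD _ _) _.
by rewrite mulr2n mulrDl mul1r lerD ?emb_norm_le ?phi_le.
Qed.

(** The domain on which F is the sum of its series is given without a bound, and it
only matters for the local statements: the radius rho does not depend on it. *)
Lemma F_eq_pfun : exists2 delta, 0 < delta &
  forall z, `|z| < delta -> F z = pfun c z.
Proof.
have /nbhs0_rowP[e e0 cFe] := cF.
exists (Num.min e (2 * rho)); first by rewrite lt_min e0.
move=> z; rewrite lt_min => /andP[ze zr].
exact: (pseries_cvg_unique rho20 c_bound zr (cFe _ ze)).
Qed.

(** As gam is at most every |l_j|, the linear part dominates the nonlinearity in the
estimate of signed_square_ge0. *)
Lemma F_lipschitz z z' : `|z| <= rho / 4 -> `|z'| <= rho / 4 ->
  d%:R * `|pfun c z - pfun c z'| <= gam / 4 * `|z - z'|.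
Proof.
move=> zr z'r; have s0 : 0 < rho / 4 by rewrite divr_gt0.
have sr : rho / 4 <= 2 * rho / 8 by rewrite le_eqVlt; apply/orP; left; apply/eqP; field.
have := pfun_lipschitz rho20 c_bound c0 s0 sr zr z'r.
have [d0|d0] := posnP d.
  rewrite (_ : d%:R = 0 :> R); last by rewrite d0.
  by rewrite mul0r => _; rewrite mulr_ge0// divr_ge0// ltW.
have {}d0 : 0 < d%:R :> R by rewrite ltr0n.
rewrite -(ler_pM2l d0) => /le_trans; apply.
rewrite [leLHS]mulrA ler_wpM2r// le_eqVlt; apply/orP; left; apply/eqP.
by field; rewrite !gt_eqF.
Qed.

(** Makes the equation for the stable coordinates a contraction. *)
Lemma phi_lipschitz x y : `|x| <= rho / 16 -> `|y| <= rho / 16 ->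
  `|phi x - phi y| <= 4^-1 * `|x - y|.
Proof.
move=> xr yr; have s0 : 0 < rho / 16 by rewrite divr_gt0.
have sr : rho / 16 <= rho / 8 by rewrite ler_wpM2l ?(ltW rho0)// lef_pV2 ?posrE// ler_nat.
have := pfun_lipschitz rho0 alphaM alpha0 s0 sr xr yr.
rewrite (_ : 4 * _ * _ / _ = 4^-1)//; field; exact: lt0r_neq0.
Qed.

(** The stable and the unstable contributions together keep the derivative of Theta
within 1/2 of the identity. *)
Lemma pder_phi_le x (h : 'rV[R]_k) : `|x| <= rho / 16 -> `|h *m pder alpha x| <= 4^-1 * `|h|.
Proof.
move=> xr; have s0 : 0 < rho / 16 by rewrite divr_gt0.
have sr : rho / 16 <= rho / 8 by rewrite ler_wpM2l ?(ltW rho0)// lef_pV2 ?posrE// ler_nat.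
have := pder_le rho0 alphaM alpha0 s0 sr h xr.
rewrite (_ : 4 * _ * _ / _ = 4^-1)//; field; exact: lt0r_neq0.
Qed.

Let emb_mx : 'M[R]_(k, d) := \matrix_(i, j) (pos j == Some i)%:R.

Let emb_mulmx x : emb pos x = x *m emb_mx.
Proof.
apply/rowP => j; rewrite !mxE; case pj: (pos j) => [i|]; last first.
  by rewrite big1// => i _; rewrite mxE pj mulr0.
rewrite (bigD1 i)//= mxE pj eqxx mulr1 big1 ?addr0// => i' ii'.
by rewrite mxE pj (inj_eq (@Some_inj _)) eq_sym (negbTE ii') mulr0.
Qed.

Let emb_diag x : emb pos x *m diag_mx l = emb pos (x *m diag_mx lam).
Proof.
apply/rowP => j; rewrite mul_mx_diag !mxE.
case pj: (pos j) => [i|]; last by rewrite mul0r.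
by rewrite mul_mx_diag !mxE; move/eqP: pj; rewrite posE => /eqP ->.
Qed.

(** Passage to the limit in the truncated equation: its left-hand side tends to
F (P x) by uniform convergence and the Lipschitz bound, the sum on the right to
the termwise derivative minus the linear part. *)
Lemma invariance delta x : 0 < delta -> (forall z, `|z| < delta -> F z = pfun c z) ->
  `|x| < rho / 8 -> 2 * `|x| < delta ->
  X (P x) = emb pos (x *m diag_mx lam) + (x *m diag_mx lam) *m pder alpha x.
Proof.
move=> delta0 Fc xr xd.
have xrho : `|x| < rho.
  apply: lt_le_trans xr _; rewrite ger_pMr// invf_le1// ler1n//.
have xr2 : 2 * `|x| <= rho / 4.
  rewrite (_ : rho / 4 = 2 * (rho / 8)); last by field.
  by rewrite ler_wpM2l// ltW.
pose z N := emb pos x + psum alpha N x.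
have q0 : 0 <= `|x| / rho by rewrite divr_ge0// ltW.
have q1 : `|x| / rho < 1 by rewrite ltr_pdivrMr// mul1r.
have xq : `|x| <= `|x| / rho * rho by rewrite divfK// gt_eqF.
have z_le N : `|z N| <= 2 * `|x|.
  apply: le_trans (ler_normD _ _) _.
  rewrite mulr2n mulrDl mul1r lerD ?emb_norm_le//.
  apply: le_trans (psum_le rho0 alpha0 alphaM N q0 (ltW q1) xq) _.
  by rewrite divfK// gt_eqF.
have zP : z @ \oo --> P x.
  by apply: cvgD; [exact: cvg_cst|exact: psum_cvg q0 q1 xq].
have Pxr : `|P x| <= rho / 4 by apply: le_trans (P_le xrho) xr2.
rewrite /X /vfield Fc; last by apply: le_lt_trans (P_le xrho) _.
rewrite /P mulmxDl emb_diag -addrA; congr (_ + _).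
suff FE : pfun c (emb pos x + phi x) =
    (x *m diag_mx lam) *m pder alpha x - phi x *m diag_mx l.
  by rewrite FE addrC subrK.
rewrite -/(P x); apply/rowP => i.
pose b := gam * rho / d%:R.
have h0 : 0 <= 2^-1 :> R by rewrite invr_ge0.
have h1 : 2^-1 < 1 :> R by rewrite invf_lt1// ltr1n.
have half0 : (fun N => 2^-1 ^+ N.+2 * b) @ \oo --> (0 : R).
  rewrite -[X in _ --> X](mul0r b); apply: cvgM; last exact: cvg_cst.
  rewrite (cvg_shiftS (fun K => 2^-1 ^+ K.+1 : R)) (cvg_shiftS (fun K => 2^-1 ^+ K : R)).
  by apply: cvg_expr; rewrite ger0_norm.
have z_le4 N : `|z N| <= rho / 4 := le_trans (z_le N) xr2.
have z_half N : `|z N| <= 2^-1 * (2 * rho).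
  apply: le_trans (z_le4 N) _; rewrite mulKf// ger_pMr// invf_le1// ler1n//.
have A : (fun N => psum c N.+1 (z N)) @ \oo --> pfun c (P x).
  apply: (@norm_cvg_squeeze _ _ _ _
    (fun N => 2^-1 ^+ N.+2 * b + gam / 4 * `|z N - P x|)) => [N|].
    rewrite -(subrKA (pfun c (z N))); apply: le_trans (ler_normD _ _) _.
    apply: lerD.
      rewrite distrC.
      exact: (@pfun_tail_le _ _ _ c _ _ rho20 c_bound _ _ N.+1 h0 h1 (z_half N)).
    apply: le_trans (F_lipschitz (z_le4 N) Pxr).
    by rewrite ler_peMl// ler1n (leq_ltn_trans _ (ltn_ord i)).
  rewrite -[X in _ --> X]addr0; apply: cvgD => //.
  rewrite -[X in _ --> X](mulr0 (gam / 4)); apply: cvgM; first exact: cvg_cst.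
  rewrite -(normr0 'rV[R]_d) -(subrr (P x)); apply: cvg_norm.
  by apply: cvgB => //; exact: cvg_cst.
pose B N := dsum alpha N.+1 x (x *m diag_mx lam) 0 i - l 0 i * psum alpha N.+1 x 0 i.
have Blim : B @ \oo --> (x *m diag_mx lam *m pder alpha x - phi x *m diag_mx l) 0 i.
  have -> : (x *m diag_mx lam *m pder alpha x - phi x *m diag_mx l) 0 i =
      (x *m diag_mx lam *m pder alpha x) 0 i - l 0 i * phi x 0 i.
    move: (x *m diag_mx lam *m pder alpha x) => A'.
    by rewrite mul_mx_diag !mxE mulrC.
  apply: cvgB.
    rewrite (cvg_shiftS (fun N => dsum alpha N x (x *m diag_mx lam) 0 i)).
    by apply: cvg_coord; apply: (dsum_cvg rho0 alphaM); exact: ltW.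
  apply: cvgM; first exact: cvg_cst.
  rewrite (cvg_shiftS (fun N => psum alpha N x 0 i)).
  by apply: cvg_coord; exact: psum_cvg q0 q1 xq.
have AB : (fun N => psum c N.+1 (z N) 0 i - B N) @ \oo --> (0 : R).
  apply: (@norm_cvg_squeeze _ _ _ _ (fun N => 2^-1 ^+ N.+2 * b)) => // N.
  rewrite subr0 (_ : B N = \sum_(m <- multis k N.+1)
      divisor lam l m i * monomial m x * alpha m 0 i).
    apply: formal_invariance => //.
    by apply: le_trans (ltW xr) _; rewrite ler_wpM2l ?(ltW rho0)// lef_pV2 ?posrE// ler_nat.
  rewrite /B dsum_euler /psum !summxE mulr_sumr -sumrB; apply: eq_bigr => m _.
  by rewrite !mxE /divisor; ring.
have : (fun N => psum c N.+1 (z N) 0 i - B N + B N) @ \oo -->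
    0 + (x *m diag_mx lam *m pder alpha x - phi x *m diag_mx l) 0 i.
  exact: cvgD.
rewrite add0r; under eq_fun do rewrite subrK; move=> AL.
by apply: cvg_unique AL => //; exact: cvg_coord A.
Qed.

Lemma P_differentiable z : `|z| < rho / 8 ->
  differentiable P z /\ jacobian P z = emb_mx + pder alpha z.
Proof.
move=> zr; apply: (@quadratic_jacobian _ _ _ _ _ _ (rho / (rho / 8) ^+ 2) (rho / 8 - `|z|)).
  by rewrite subr_gt0.
move=> h hz.
have -> : P (h + z) - P z - h *m (emb_mx + pder alpha z) =
    phi (h + z) - phi z - h *m pder alpha z.
  rewrite /P !emb_mulmx mulmxDr mulmxDl; apply/rowP => j.
  move: (h *m emb_mx) (z *m emb_mx) (h *m pder alpha z) (phi _) (phi z) => A B C D E.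
  by rewrite !mxE; ring.
apply: (pfun_taylor1 rho0 alphaM); first exact: ltW.
by apply: le_trans (ler_normD _ _) _; rewrite -lerBrDr ltW.
Qed.

(** By the invariance equation, P sends orbits of the linear flow to orbits of X. *)
Lemma stable_orbit delta x (v := fun t => P (linflow lam x t)) :
  0 < delta -> (forall z, `|z| < delta -> F z = pfun c z) ->
  `|x| < rho / 8 -> 2 * `|x| < delta ->
  [/\ v 0 = P x, forall t : R, 0 <= t -> is_derive t 1 v (X (v t)),
      forall t, 0 <= t -> `|v t| <= 2 * `|x|
    & v t @[t --> +oo] --> (0 : 'rV[R]_d)].
Proof.
move=> delta0 Fc xr xd.
have lam_le i : lam 0 i <= - gam by rewrite mxE.
have yx (t : R) : 0 <= t -> `|linflow lam x t| <= `|x|.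
  exact: (linflow_norm_le gam0 lam_le).
have r8 : rho / 8 < rho by rewrite gtr_pMr// invf_lt1// ltr1n.
have vy (t : R) : 0 <= t -> `|v t| <= 2 * `|linflow lam x t|.
  by move=> t0; apply: P_le; apply: le_lt_trans (yx _ t0) (lt_trans xr r8).
split.
- by rewrite /v linflow0.
- move=> t t0; set y := linflow lam x.
  have yr : `|y t| < rho / 8 by exact: le_lt_trans (yx _ t0) xr.
  have [dP PE] := P_differentiable yr.
  have dy := is_derive_linflow lam x t; rewrite -/y in dy.
  have dyt : differentiable y t by apply/derivable1_diffP; exact: ex_derive.
  have dv : differentiable (P \o y) t by exact: differentiable_comp.
  rewrite (_ : v = P \o y)//; apply: DeriveDef; first exact/derivable1_diffP.
  have dyE : 'd y t 1 = y t *m diag_mx lam by rewrite -deriveE//; case: dy.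
  rewrite deriveE// diff_comp//= dyE -deriveE// deriveEjacobian// PE mulmxDr -emb_mulmx.
  rewrite (@invariance delta)//.
  by apply: le_lt_trans xd; rewrite ler_wpM2l// yx.
- by move=> t t0; apply: le_trans (vy _ t0) _; rewrite ler_wpM2l// yx.
- apply/cvgr0Pnorm_le => e e0.
  have /cvgr0Pnorm_le y0 := linflow_cvg0 gam0 lam_le x.
  have e20 : 0 < e / 2 by rewrite divr_gt0.
  near=> t; have t0 : 0 <= t by near: t; apply: nbhs_pinfty_ge; exact: num_real.
  apply: le_trans (vy _ t0) _; rewrite mulrC -ler_pdivlMr//.
  by near: t; exact: y0.
Unshelve. all: by end_near. Qed.

Let sgn (j : 'I_d) : R := if pos j is Some _ then -1 else 1.

Let sgn_norm j : `|sgn j| = 1.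
Proof. by rewrite /sgn; case: (pos j) => [i|]; rewrite ?normrN normr1. Qed.

Let sgn_l j : gam <= sgn j * l 0 j.
Proof.
rewrite /sgn; case pj: (pos j) => [i|]; last by rewrite mul1r l_unstable.
by move/eqP: pj; rewrite posE => /eqP <-; rewrite mulN1r lerNr.
Qed.

Let sqr_norm_le (w : 'rV[R]_d) : `|w| ^+ 2 <= \sum_j w 0 j ^+ 2.
Proof.
have S0 : 0 <= \sum_j w 0 j ^+ 2 by apply: sumr_ge0 => j _; exact: sqr_ge0.
rewrite -[leRHS]sqr_sqrtr// lerXn2r ?nnegrE ?sqrtr_ge0//.
apply: norm_le_coord => [|j]; first exact: sqrtr_ge0.
rewrite -sqrtr_sqr ler_wsqrtr// (bigD1 j)//= lerDl.
by apply: sumr_ge0 => i _; exact: sqr_ge0.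
Qed.

(** The derivative of the signed sum of squares when w has derivative
w *m diag_mx l + f: the linear part contributes at least 2 gam times the sum of
the squares, the part f at most gam / 2 times the square of the sup norm. *)
Lemma signed_square_ge0 (w f : 'rV[R]_d) : d%:R * `|f| <= gam / 4 * `|w| ->
  0 <= \sum_j sgn j *: ((2%:R * w 0 j ^+ 1) *: (w 0 j * l 0 j + f 0 j)).
Proof.
move=> fw; pose A := \sum_j (gam * w 0 j ^+ 2 - `|w| * `|f|).
have A0 : 0 <= A.
  rewrite /A sumrB -mulr_sumr sumr_const card_ord subr_ge0.
  apply: (@le_trans _ _ (gam * `|w| ^+ 2)); last by rewrite ler_pM2l.
  rewrite -mulr_natl [leLHS](_ : _ = `|w| * (d%:R * `|f|)); last by ring.
  rewrite [leRHS](_ : _ = `|w| * (gam * `|w|)) ?ler_wpM2l//; last by ring.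
  apply: le_trans fw _; rewrite ler_wpM2r// ler_pdivrMr// ler_peMr ?ler1n// ltW//.
apply: (@le_trans _ _ (2 * A)); first by rewrite mulr_ge0.
rewrite /A mulr_sumr; apply: ler_sum => j _.
rewrite expr1 (_ : sgn j *: _ = 2 * ((sgn j * l 0 j) * w 0 j ^+ 2
                                     + sgn j * (w 0 j * f 0 j))); last first.
  by rewrite /GRing.scale /=; ring.
rewrite ler_wpM2l// lerD// ?ler_wpM2r ?sqr_ge0//.
rewrite lerNl; apply: le_trans (ler_norm _) _.
rewrite normrN normrM sgn_norm mul1r normrM ler_pM//; exact: norm_coord.
Qed.

(** The signed sum of squares q of the difference of the orbits is nondecreasing
and tends to 0, hence q 0 <= 0; but the stable coordinates of the difference
vanish at time 0, so that q 0 is the full sum of squares. *)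
Lemma orbits_coincide delta (u v : R -> 'rV[R]_d) :
  (forall z, `|z| < delta -> F z = pfun c z) ->
  (forall t : R, 0 <= t -> is_derive t 1 u (X (u t))) ->
  (forall t : R, 0 <= t -> is_derive t 1 v (X (v t))) ->
  (forall t, 0 <= t -> `|u t| <= rho / 4 /\ `|u t| < delta) ->
  (forall t, 0 <= t -> `|v t| <= rho / 4 /\ `|v t| < delta) ->
  u t @[t --> +oo] --> (0 : 'rV[R]_d) ->
  v t @[t --> +oo] --> (0 : 'rV[R]_d) ->
  (forall i, u 0 0 (idx i) = v 0 0 (idx i)) -> u 0 = v 0.
Proof.
move=> Fc du dv ur vr u0 v0 uv.
pose w t := u t - v t.
pose dw t := w t *m diag_mx l + (pfun c (u t) - pfun c (v t)).
have wd (t : R) : 0 <= t -> is_derive t 1 w (dw t).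
  move=> t0; have ? := du t t0; have ? := dv t t0.
  apply: is_derive_eq; rewrite /X /vfield /dw /w.
  rewrite !Fc; [|by have [] := vr t t0|by have [] := ur t t0].
  by rewrite mulmxBl opprD addrACA.
pose q t := \sum_j sgn j * (w t 0 j) ^+ 2.
have qd (t : R) : 0 <= t -> is_derive t 1 q
    (\sum_j sgn j *: ((2%:R * w t 0 j ^+ 1) *: (dw t 0 j))).
  move=> t0; rewrite (_ : q = \sum_(j < d) sgn j \*: ((fun s => w s 0 j) ^+ 2)).
    apply: is_derive_sum => j; apply: is_deriveZ.
    have ? := is_derive_coord j (wd t t0).
    exact: is_deriveX.
  apply/funext => s; rewrite /q fct_sumE; apply: eq_bigr => j _.
  by [].
have q_mono T : 0 <= T -> q 0 <= q T.
  move=> T0; apply: (derive_ge0_le T0 qd) => t t0.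
  have := @signed_square_ge0 (w t) (pfun c (u t) - pfun c (v t)).
  have [ur1 _] := ur t t0; have [vr1 _] := vr t t0.
  move=> /(_ (F_lipschitz ur1 vr1)) /=; congr (0 <= _); apply: eq_bigr => j _.
  have dwE (a b : 'rV[R]_d) : (a *m diag_mx l + b) 0 j = a 0 j * l 0 j + b 0 j.
    by rewrite mul_mx_diag !mxE.
  by rewrite /dw dwE.
have w0 : w t @[t --> +oo] --> (0 : 'rV[R]_d).
  by rewrite -(subr0 0); apply: cvgB.
have q_le T : 0 <= T -> q 0 <= d%:R * (`|w T| * `|w T|).
  move=> T0; apply: le_trans (q_mono T T0) _.
  rewrite mulr_natl -[X in _ *+ X]card_ord -sumr_const; apply: ler_sum => j _.
  apply: le_trans (ler_norm _) _; rewrite normrM sgn_norm mul1r normrX expr2.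
  by rewrite ler_pM// norm_coord.
have q0 : q 0 <= 0.
  pose g (T : R) := d%:R * (`|w T| * `|w T|).
  have lim0 : g T @[T --> +oo] --> (0 : R).
    rewrite -[X in _ --> X](mulr0 d%:R); apply: cvgM; first exact: cvg_cst.
    rewrite -[X in _ --> X](mulr0 0); have nw : `|w t| @[t --> +oo] --> (0 : R).
      by rewrite -(normr0 'rV[R]_d); apply: cvg_norm.
    exact: cvgM.
  suff : q 0 <= lim (g T @[T --> +oo]) by rewrite (cvg_lim _ lim0).
  apply: limr_ge; first by apply/cvg_ex; exists 0.
  near=> T; apply: q_le; near: T; apply: nbhs_pinfty_ge; exact: num_real.
have qE : q 0 = \sum_j (w 0 0 j) ^+ 2.
  apply: eq_bigr => j _; rewrite /sgn; case pj: (pos j) => [i|]; last by rewrite mul1r.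
  move/eqP: pj; rewrite posE => /eqP <-.
  by rewrite /w !mxE uv subrr expr0n/= mulr0.
apply/eqP; rewrite -subr_eq0 -normr_eq0 -sqrf_eq0 -/(w 0).
by rewrite eq_le sqr_ge0 andbT; apply: le_trans (sqr_norm_le _) _; rewrite -qE.
Unshelve. all: by end_near. Qed.

(** The stable coordinates of P are a contractive perturbation of the identity. *)
Lemma stable_coordinate_solution (z : 'rV[R]_d) : `|z| <= rho / 32 ->
  exists2 x, `|x| <= 2 * `|z| & forall i, P x 0 (idx i) = z 0 (idx i).
Proof.
move=> zr.
have e16 : 2 * `|z| <= rho / 16.
  by rewrite (_ : rho / 16 = 2 * (rho / 32)) ?ler_wpM2l//; field.
have phi00 : phi 0 = 0 by exact: pfun0 rho0 alpha0 alphaM.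
pose f (x : 'rV[R]_k) : 'rV[R]_k := \row_i (z 0 (idx i) - phi x 0 (idx i)).
have e0 : 0 <= 2 * `|z| by rewrite mulr_ge0.
have [||x xz xf] := @half_contraction_fixpoint R k f _ e0.
- move=> x xe; apply: norm_le_coord => // i; rewrite mxE.
  apply: le_trans (ler_normB _ _) _.
  have := phi_lipschitz (le_trans xe e16) (_ : `|0 : 'rV[R]_k| <= rho / 16).
  rewrite normr0 phi00 !subr0 => /(_ (le_trans e0 e16)) phix.
  have := norm_coord (phi x) (idx i); have := norm_coord z (idx i).
  move: xe phix; lra.
- move=> x y xe ye; apply: norm_le_coord => [|i]; first by rewrite mulr_ge0// invr_ge0.
  have -> : (f x - f y) 0 i = (phi y - phi x) 0 (idx i) by rewrite !mxE; ring.
  apply: le_trans (norm_coord _ _) _; rewrite distrC.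
  apply: le_trans (phi_lipschitz (le_trans ye e16) (le_trans xe e16)) _.
  by rewrite ler_wpM2r// lef_pV2 ?posrE// ler_nat.
exists x => // i; rewrite [in LHS]xf /P mxE /emb mxE pos_idx.
by rewrite [in X in X + _]mxE -xf subrK.
Qed.

(** The neighbourhood is so small that the comparison orbit on the graph, which
starts at a parameter of norm at most twice that of the given point and may
double its norm again, stays where F is the sum of its series and the Lipschitz
bound holds. *)
Lemma parametrises_stable : parametrises P (disc (rho / 2)) (local_stable_set X).
Proof.
have [delta delta0 Fc] := F_eq_pfun.
pose eta := Num.min (rho / 32) (delta / 8).
have eta0 : 0 < eta by rewrite lt_min !divr_gt0.
exists [set z : 'rV[R]_d | `|z| < eta]; first by apply/nbhs0_rowP; exists eta.
move=> N /nbhs0_rowP[e e0 Ne] NN0.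
exists [set x : 'rV[R]_k | `|x| < rho / 8 /\ local_stable_set X N (P x)]; split.
- apply/nbhs0_rowP; pose e' := Num.min (rho / 8) (Num.min (delta / 2) (e / 2)).
  exists e'; first by rewrite /= !lt_min !divr_gt0.
  move=> x /=; rewrite !lt_min => /and3P[xr xd xe]; split=> //.
  rewrite ltr_pdivlMr// mulrC in xd; rewrite ltr_pdivlMr// mulrC in xe.
  have [v0 dv vx vlim] := stable_orbit delta0 Fc xr xd.
  exists (fun t => P (linflow lam x t)); split => // t t0.
  by apply: Ne => /=; apply: le_lt_trans (vx t t0) xe.
- move=> x [xr _]; rewrite /disc /=; apply: lt_le_trans xr _.
  by rewrite ler_wpM2l ?(ltW rho0)// lef_pV2 ?posrE// ler_nat.
- apply/seteqP; split=> [z zW|_ [x [_ xW] <-]]//.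
  have [u [u0 du uN ulim]] := zW.
  have u_lt t : 0 <= t -> `|u t| < eta by move=> t0; apply: NN0; exact: uN.
  have := u_lt 0 (lexx _); rewrite u0 lt_min => /andP[zr zd].
  have [x xz Px] := stable_coordinate_solution (ltW zr).
  have xr : `|x| < rho / 16 by move: xz zr; lra.
  have xr8 : `|x| < rho / 8 by move: xr rho0; lra.
  have xd : 2 * `|x| < delta by move: xz zd; lra.
  have [v0 dv vx vlim] := stable_orbit delta0 Fc xr8 xd.
  have zE : z = P x.
    rewrite -u0 -v0; apply: (@orbits_coincide delta) => //.
    + move=> t t0; have := u_lt t t0; rewrite lt_min => /andP[].
      by move: rho0 delta0; split; lra.
    + move=> t t0; have := vx t t0; move: xd xr rho0; split; lra.
    + by move=> i; rewrite u0 v0 Px.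
  by exists x => //=; rewrite -zE.
Qed.

(** With rho = 2 r, the tail beyond degree n1 is at most
2 r (q / 2) ^ n1.+1 <= r q ^ n1.+1 where q = |x| / r; the factor (1 - q)^-1 > 1
makes the inclusion in the open disc strict. *)
Lemma phi_tail_bound n1 x (r := rho / 2) : `|x| < r ->
  scale_set (r * (`|x| / r) ^+ n1.+1 * (1 - `|x| / r)^-1) (disc 1)
    (phi x - taylor_part alpha n1 x).
Proof.
move=> xr; have r0 : 0 < r by rewrite divr_gt0.
pose q := `|x| / r; have q0 : 0 <= q by rewrite divr_ge0// ltW.
have q1 : q < 1 by rewrite ltr_pdivrMr// mul1r.
have xE : `|x| = q / 2 * rho.
  by rewrite /q /r; field; rewrite gt_eqF.
have q20 : 0 <= q / 2 by rewrite divr_ge0.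
have q21 : q / 2 < 1 by move: q1; lra.
have tail : `|phi x - taylor_part alpha n1 x| <= r * q ^+ n1.+1.
  rewrite taylor_part_psum//.
  have := pfun_tail_le rho0 alphaM n1 q20 q21.
  move=> /(_ x); rewrite -xE lexx => /(_ isT) /le_trans; apply.
  rewrite exprMn (exprS 2^-1).
  rewrite (_ : _ * rho = r * q ^+ n1.+1 * 2^-1 ^+ n1); last by rewrite /r; field.
  apply: ler_piMr; first by rewrite mulr_ge0 ?exprn_ge0// ltW.
  by apply: exprn_ile1; rewrite ?invr_ge0// invf_le1// ler1n.
rewrite -/q; set t := _ * _^-1.
have [q_eq0|q_neq0] := eqVneq q 0.
  exists 0; first by rewrite /disc /= normr0.
  apply/esym/eqP; rewrite scaler0 -normr_le0; apply: le_trans tail _.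
  by rewrite q_eq0 expr0n/= mulr0.
have qp : 0 < q by rewrite lt_def q_neq0.
have tail_t : r * q ^+ n1.+1 < t.
  rewrite /t ltr_pMr ?mulr_gt0 ?exprn_gt0// invf_gt1 ?subr_gt0//.
  by rewrite gtrBl.
have t0 : 0 < t by apply: le_lt_trans tail_t; rewrite mulr_ge0 ?exprn_ge0// ltW.
exists (t^-1 *: (phi x - taylor_part alpha n1 x)); last first.
  by rewrite scalerA divff ?scale1r// gt_eqF.
rewrite /disc /= normrZ gtr0_norm ?invr_gt0// mulrC ltr_pdivrMr// mul1r.
exact: le_lt_trans tail tail_t.
Qed.

(** J is the derivative of ph, given through its remainder so that it can be
combined into the derivative of Theta. *)
Lemma stable_manifold (r := rho / 2) :
  exists (al : mindex k -> 'rV[R]_d) (ph : 'rV[R]_k -> 'rV[R]_d)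
         (J : 'rV[R]_k -> 'M[R]_(k, d)) (K r' : R),
  [/\ no_low_terms al,
      forall x, `|x| < r -> pseries_cvg al x (ph x),
      parametrises (fun x => emb pos x + ph x) (disc r) (local_stable_set X),
      forall n1 x, `|x| < r ->
        scale_set (r * (`|x| / r) ^+ n1.+1 * (1 - `|x| / r)^-1) (disc 1)
          (ph x - taylor_part al n1 x) &
      0 < r' /\ ph 0 = 0 /\ forall x, `|x| < r' ->
      [/\ X (emb pos x + ph x) =
            emb pos (x *m diag_mx lam) + (x *m diag_mx lam) *m J x,
          forall h : 'rV[R]_k, `|h *m J x| <= 4^-1 * `|h| &
          forall h : 'rV[R]_k, `|h + x| < r' ->
            `|ph (h + x) - ph x - h *m J x| <= K * `|h| ^+ 2]].
Proof.
have [delta delta0 Fc] := F_eq_pfun.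
exists alpha, phi, (pder alpha), (rho / (rho / 8) ^+ 2).
exists (Num.min (rho / 16) (delta / 2)); split=> //.
- move=> x xr; apply: (pseries_cvg_pfun rho0 alphaM).
  by apply: lt_trans xr _; rewrite gtr_pMr// invf_lt1// ltr1n.
- exact: parametrises_stable.
- exact: phi_tail_bound.
split; first by rewrite lt_min !divr_gt0.
split; first exact: pfun0 rho0 alpha0 alphaM.
move=> x; rewrite lt_min => /andP[xr xd].
have r16_8 : rho / 16 < rho / 8 by move: rho0; lra.
split.
- apply: (@invariance delta) => //; first exact: lt_trans xr r16_8.
  by move: xd; lra.
- by move=> h; apply: pder_phi_le; exact: ltW.
- move=> h; rewrite lt_min => /andP[hr _]; apply: (pfun_taylor1 rho0 alphaM).
    by apply/ltW/(lt_trans xr).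
  by apply/ltW/(lt_trans hr).
Qed.

End StableManifold.

(** * Programs with oracles *)

Section OraclePrograms.

Definition oracle := nat -> seq nat -> nat.

(** The list of arguments serves as an environment of known length L; the value on
lists of another length is immaterial. *)
Definition computable L (g : oracle -> seq nat -> nat) :=
  exists e, forall O s, size s = L -> recfun_val O e s (g O s).

Implicit Types (L : nat) (f g h t : oracle -> seq nat -> nat).

Lemma computable_ext L g h : (forall O s, size s = L -> g O s = h O s) ->
  computable L g -> computable L h.
Proof. by move=> gh [e eg]; exists e => O s sL; rewrite -gh//; exact: eg. Qed.

Lemma computable_comp L L' g (hs : seq (oracle -> seq nat -> nat)) :
  computable L' g -> size hs = L' -> List.Forall (computable L) hs ->
  computable L (fun O s => g O [seq h O s | h <- hs]).
Proof.
move=> [e eg] sz Hhs.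
suff [es es_val] : exists es, forall O s, size s = L ->
    (fix vals (hs : seq recfun) (vs : seq nat) : Prop :=
         match hs, vs with
         | [::], [::] => True
         | h :: hs', w :: vs' => recfun_val O h s w /\ vals hs' vs'
         | _, _ => False
         end) es [seq h O s | h <- hs].
  exists (Comp e es) => O s sL /=; exists [seq h O s | h <- hs].
    exact: es_val.
  by apply: eg; rewrite size_map.
elim: Hhs {sz} => [|h hs' [eh ehP] _ [es esP]]; first by exists [::].
by exists (eh :: es) => O s sL; split; [exact: ehP|exact: esP].
Qed.

Lemma computable_proj L i : computable L (fun O s => nth 0%N s i).
Proof. by exists (Proj i). Qed.

Lemma computable_succ L g : computable L g -> computable L (fun O s => (g O s).+1).
Proof.
move=> gc; apply: (@computable_comp _ 1 (fun O s => (head 0%N s).+1) [:: g]) => //.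
  by exists Succ.
by constructor.
Qed.

Lemma computable_const L n : computable L (fun=> fun=> n).
Proof.
elim: n => [|n IH]; first by exists Zero.
exact: computable_succ IH.
Qed.

Lemma computable_oracle L i g h : computable L g -> computable L h ->
  computable L (fun O s => O i [:: g O s; h O s]).
Proof.
move=> gc hc; apply: (@computable_comp _ 2 (fun O s => O i s) [:: g; h]) => //.
  by exists (Oracle i).
by do 2 constructor => //.
Qed.

Lemma computable_select L L' g (is_ : seq nat) : computable L' g ->
  size is_ = L' -> computable L (fun O s => g O [seq nth 0%N s i | i <- is_]).
Proof.
move=> gc sz.
have := @computable_comp L L' g [seq (fun O s => nth 0%N s i) | i <- is_] gc.
rewrite size_map => /(_ sz) H; apply: computable_ext (H _).
  by move=> O s _; rewrite -map_comp.
by elim: is_ {sz H} => [|i is_ IH] /=; constructor => //; exact: computable_proj.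
Qed.

Lemma nth_iota_id (s : seq nat) : [seq nth 0%N s i | i <- iota 0 (size s)] = s.
Proof. exact: mkseq_nth. Qed.

Lemma nth_iota_drop (s : seq nat) n :
  [seq nth 0%N s i | i <- iota n (size s - n)] = drop n s.
Proof.
rewrite -{1}(addn0 n) iotaDl -map_comp -size_drop.
rewrite -[RHS]nth_iota_id; apply: eq_map => i /=.
by rewrite nth_drop.
Qed.

Lemma computable_drop L n g : computable L g ->
  computable (n + L) (fun O s => g O (drop n s)).
Proof.
move=> gc; have sz : size (iota n L) = L by rewrite size_iota.
apply: computable_ext (computable_select (n + L) gc sz) => O s sL.
by rewrite -nth_iota_drop sL addKn.
Qed.

Lemma computable_cons L g h : computable L.+1 g -> computable L h ->
  computable L (fun O s => g O (h O s :: s)).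
Proof.
move=> gc hc.
have := @computable_comp L L.+1 g
  (h :: [seq (fun O s => nth 0%N s i) | i <- iota 0 L]) gc.
rewrite /= size_map size_iota => /(_ erefl) H; apply: computable_ext (H _).
  by move=> O s sL; rewrite -map_comp -sL nth_iota_id.
constructor=> //; elim: (iota 0 L) => [|i is_ IH] /=; constructor => //.
exact: computable_proj.
Qed.

Definition iterate (a : nat) (b : nat -> nat -> nat) (n : nat) :=
  nat_rect (fun=> nat) a b n.

(** The environment is passed on unchanged to the recursion step, below the counter
and the current value. *)
Lemma computable_iterate L t f g : computable L t -> computable L f ->
  computable L.+2 g ->
  computable L (fun O s => iterate (f O s) (fun i w => g O [:: i, w & s]) (t O s)).
Proof.
move=> tc [ef efP] [eg egP].
apply: (@computable_cons L (fun O s =>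
  iterate (f O (behead s)) (fun i w => g O [:: i, w & behead s]) (head 0%N s)) t) => //.
exists (PrimRec ef eg) => O [//|n s] [sL] /=.
exists (iterate (f O s) (fun i w => g O [:: i, w & s])); split => //=.
  exact: efP.
by move=> i _; apply: egP; rewrite /= sL.
Qed.

(** Naming the least zero m in advance guarantees that the search terminates. *)
Lemma computable_minimization L g m : computable L.+1 g ->
  (forall O s, size s = L -> g O (m O s :: s) = 0%N) ->
  (forall O s i, size s = L -> (i < m O s)%N -> (0 < g O (i :: s))%N) ->
  computable L m.
Proof.
move=> [e eg] g0 gp; exists (Mu e) => O s sL /=; split.
  by rewrite -(g0 O s)//; apply: eg; rewrite /= sL.
move=> i im; exists (g O (i :: s)).-1; rewrite prednK ?gp//.
by apply: eg; rewrite /= sL.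
Qed.

Lemma computable_weaken2 L g : computable L g ->
  computable L.+2 (fun O s => g O (drop 2 s)).
Proof. exact: (@computable_drop L 2). Qed.

Lemma computable_add L f g : computable L f -> computable L g ->
  computable L (fun O s => f O s + g O s)%N.
Proof.
move=> fc gc; have := computable_iterate fc gc (computable_succ (computable_proj L.+2 1)).
apply: computable_ext => O s _; rewrite /iterate.
by elim: (f O s) => //= n ->.
Qed.

Lemma computable_pred L f : computable L f -> computable L (fun O s => (f O s).-1).
Proof.
move=> fc; have := computable_iterate fc (computable_const L 0) (computable_proj L.+2 0).
by apply: computable_ext => O s _; rewrite /iterate; case: (f O s).
Qed.

Lemma computable_sub L f g : computable L f -> computable L g ->
  computable L (fun O s => f O s - g O s)%N.
Proof.
move=> fc gc; have := computable_iterate gc fc (computable_pred (computable_proj L.+2 1)).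
apply: computable_ext => O s _; rewrite /iterate.
by elim: (g O s) => /= [|n ->]; rewrite ?subn0// subnS.
Qed.

Lemma computable_mul L f g : computable L f -> computable L g ->
  computable L (fun O s => f O s * g O s)%N.
Proof.
move=> fc gc; have := computable_iterate fc (computable_const L 0)
  (computable_add (computable_weaken2 gc) (computable_proj L.+2 1)).
apply: computable_ext => O s _; rewrite /iterate /= drop0.
by elim: (f O s) => //= n ->; rewrite mulSn.
Qed.

Lemma computable_pow2 L f : computable L f -> computable L (fun O s => 2 ^ f O s)%N.
Proof.
move=> fc; have := computable_iterate fc (computable_const L 1)
  (computable_add (computable_proj L.+2 1) (computable_proj L.+2 1)).
apply: computable_ext => O s _; rewrite /iterate /=.
by elim: (f O s) => //= n ->; rewrite expnS mul2n addnn.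
Qed.

Lemma computable_if_pos L f g h : computable L f -> computable L g ->
  computable L h ->
  computable L (fun O s => if (0 < f O s)%N then g O s else h O s).
Proof.
move=> fc gc hc; have := computable_iterate fc hc (computable_weaken2 gc).
by apply: computable_ext => O s _; rewrite /iterate; case: (f O s) => //= n; rewrite drop0.
Qed.

Lemma computable_odd L f : computable L f -> computable L (fun O s => nat_of_bool (odd (f O s))).
Proof.
move=> fc; have := computable_iterate fc (computable_const L 0)
  (computable_sub (computable_const L.+2 1) (computable_proj L.+2 1)).
apply: computable_ext => O s _; rewrite /iterate /=.
by elim: (f O s) => //= n ->; case: (odd n).
Qed.

Lemma computable_half L f : computable L f -> computable L (fun O s => (f O s)./2).
Proof.
move=> fc; have := computable_iterate fc (computable_const L 0)
  (computable_add (computable_odd (computable_proj L.+2 0)) (computable_proj L.+2 1)).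
apply: computable_ext => O s _; rewrite /iterate /=.
by elim: (f O s) => //= n ->; rewrite uphalf_half.
Qed.

Lemma computable_min L f g : computable L f -> computable L g ->
  computable L (fun O s => minn (f O s) (g O s)).
Proof.
move=> fc gc; have := computable_sub fc (computable_sub fc gc).
by apply: computable_ext => O s _; rewrite minnE.
Qed.

Lemma computable_big L (op : nat -> nat -> nat) (I : Type) (r : seq I)
    (F : I -> oracle -> seq nat -> nat) f :
  (forall g h, computable L g -> computable L h ->
     computable L (fun O s => op (g O s) (h O s))) ->
  computable L f -> (forall i, computable L (F i)) ->
  computable L (fun O s => \big[op/f O s]_(i <- r) F i O s).
Proof.
move=> opc fc Fc; elim: r => [|i r IH].
  by apply: computable_ext fc => O s _; rewrite big_nil.
by apply: computable_ext (opc _ _ (Fc i) IH) => O s _; rewrite big_cons.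
Qed.

(** The quotient is found by search, as the least v with f < v.+1 * g. *)
Lemma computable_div L f g : computable L f -> computable L g ->
  (forall O s, size s = L -> (0 < g O s)%N) ->
  computable L (fun O s => f O s %/ g O s)%N.
Proof.
move=> fc gc g0.
have w h : computable L h -> computable L.+1 (fun O s => h O (behead s)).
  move=> /(@computable_drop L 1); apply: computable_ext => O s _.
  by rewrite drop1.
apply: (@computable_minimization L (fun O s =>
  (f O (behead s)).+1 - (nth 0 s 0).+1 * g O (behead s))%N).
- apply: computable_sub; first exact/computable_succ/w.
  apply: computable_mul; last exact: w.
  exact/computable_succ/computable_proj.
- by move=> O s sL; apply/eqP; rewrite subn_eq0 /= ltn_ceil// g0.
- move=> O s i sL /=; rewrite leq_divRL ?g0// => ig.
  by rewrite subn_gt0 ltnS.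
Qed.

End OraclePrograms.

Section NestedMinimum.
Variables (T : Type) (op : T -> T -> T).

Definition iter_op (f : nat -> T) (N : nat) : T :=
  nat_rect (fun=> T) (f 0%N) (fun i w => op w (f i.+1)) N.

(** The combination by op of the values of f on all vectors of j numbers at most N,
as j nested loops.  Since j is fixed before the program is written, each loop
is a single primitive recursion and no enumeration of vectors has to be coded. *)
Fixpoint nested_op (f : seq nat -> T) (N j : nat) (s : seq nat) : T :=
  if j is j'.+1 then iter_op (fun x => nested_op f N j' (x :: s)) N else f s.

End NestedMinimum.

Lemma computable_nested_min j L t f : computable L t -> computable (j + L) f ->
  computable L (fun O s => nested_op minn (f O) (t O s) j s).
Proof.
elim: j L t f => [|j IH] L t f tc fc //=.
have tc1 : computable L.+1 (fun O s => t O (drop 1 s)).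
  exact: (@computable_drop L 1).
have fc1 : computable (j + L.+1) f by rewrite addnS.
have gc := IH _ _ _ tc1 fc1.
have hc : computable L.+3 (fun O s => nested_op minn (f O)
    (t O (drop 1 [seq nth 0%N s i | i <- 0%N :: iota 3 L])) j
    [seq nth 0%N s i | i <- 0%N :: iota 3 L]).
  apply: (computable_select L.+3 (g := fun O s => nested_op minn (f O) (t O (drop 1 s)) j s) gc).
  by rewrite /= size_iota.
have sc := computable_cons hc (computable_succ (computable_proj L.+2 0)).
have := computable_iterate tc (computable_cons gc (computable_const L 0))
  (computable_min (computable_proj L.+2 1) sc).
apply: computable_ext => O s sL; rewrite /iterate /iter_op /= drop0.
congr nat_rect; apply/funext => i; apply/funext => w; congr minn.
have -> : [seq nth 0%N [:: i.+1, i, w & s] u | u <- iota 3 L] = s.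
  have := nth_iota_drop [:: i.+1, i, w & s] 3.
  by rewrite /= sL !subSS subn0 drop0.
by rewrite drop0.
Qed.

(** * The distance to resonance *)

Section NestedMinimumTheory.

Lemma iter_op_rel (T T' : Type) (rel : T -> T' -> Prop) op op'
    (f : nat -> T) (f' : nat -> T') N :
  (forall x y x' y', rel x x' -> rel y y' -> rel (op x y) (op' x' y')) ->
  (forall x, (x <= N)%N -> rel (f x) (f' x)) ->
  rel (iter_op op f N) (iter_op op' f' N).
Proof.
move=> opP; elim: N => [|N IH] fP /=; first exact: fP.
by apply: opP; [apply: IH => x /leqW; exact: fP|exact: fP].
Qed.

Lemma nested_op_rel (T T' : Type) (rel : T -> T' -> Prop) op op'
    (f : seq nat -> T) (f' : seq nat -> T') N j s s' :
  (forall x y x' y', rel x x' -> rel y y' -> rel (op x y) (op' x' y')) ->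
  (forall ms, size ms = j -> all (fun m => m <= N)%N ms ->
     rel (f (ms ++ s)) (f' (ms ++ s'))) ->
  rel (nested_op op f N j s) (nested_op op' f' N j s').
Proof.
move=> opP; elim: j s s' => [|j IH] s s' fP /=; first exact: (fP [::]).
apply: iter_op_rel => // x xN; apply: IH => ms sz msN.
rewrite -!cat_rcons; apply: fP; first by rewrite size_rcons sz.
by rewrite all_rcons xN.
Qed.

Variable R : realType.

Lemma iter_min_le (f : nat -> R) N x : (x <= N)%N -> iter_op Num.min f N <= f x.
Proof.
elim: N => [|N IH] /=; first by rewrite leqn0 => /eqP ->.
rewrite ge_min leq_eqVlt => /predU1P[->|xN]; first by rewrite lexx orbT.
by rewrite IH.
Qed.

Lemma nested_min_le (f : seq nat -> R) N ms s : all (fun m => m <= N)%N ms ->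
  nested_op Num.min f N (size ms) s <= f (ms ++ s).
Proof.
elim/last_ind: ms s => [|ms x IH] s //=.
rewrite all_rcons size_rcons cat_rcons => /andP[xN msN] /=.
by apply: le_trans (IH _ msN); exact: iter_min_le xN.
Qed.

End NestedMinimumTheory.

Section Gap.
Variables (R : realType) (n : nat) (l : 'rV[R]_n).
Implicit Types (s : seq nat).

Definition weight s := (\sum_(j < n) nth 0 s j)%N.

(** The value 1 on exponents of degree below 2, which are not constrained, is neutral
in the minimum gap_base. *)
Definition divisor_or_one s i : R :=
  if (1 < weight s)%N then `|\sum_(j < n) (nth 0%N s j)%:R * l 0 j - l 0 i|
  else 1.

(** The constant 1 and the |l_i| make gap a bound for the divisors of all
multi-indices at once: when n1 exceeds the ratio of the extreme eigenvalues, the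
divisors with some exponent beyond n1 are at least the smallest |l_i|. *)
Definition gap_base s : R :=
  \big[Num.min/1]_i Num.min `|l 0 i| (divisor_or_one s i).

Definition gap n1 : R := nested_op Num.min gap_base n1 n [::].

Lemma gap_le n1 ms : size ms = n -> all (fun m => m <= n1)%N ms ->
  gap n1 <= gap_base ms.
Proof.
by move=> sz msn; rewrite -[ms]cats0 /gap -{1}sz; exact: nested_min_le.
Qed.

Lemma gap_base_le1 s : gap_base s <= 1.
Proof. exact: bigmin_le_id. Qed.

Lemma gap_base_le s i : gap_base s <= Num.min `|l 0 i| (divisor_or_one s i).
Proof. exact: bigmin_le_cond. Qed.

Lemma gap_le_base n1 : exists2 ms, size ms = n & gap n1 <= gap_base ms.
Proof.
exists (nseq n 0%N); first by rewrite size_nseq.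
by apply: gap_le; rewrite ?size_nseq// all_nseq orbT.
Qed.

Lemma gap_le1 n1 : gap n1 <= 1.
Proof. by have [ms _ /le_trans] := gap_le_base n1; apply; exact: gap_base_le1. Qed.

Lemma gap_le_norm n1 i : gap n1 <= `|l 0 i|.
Proof.
have [ms _ /le_trans] := gap_le_base n1; apply; apply: le_trans (gap_base_le _ i) _.
by rewrite ge_min lexx.
Qed.

Lemma gap_le_divisor n1 (m : mindex n) i : (2 <= mdeg m)%N ->
  (forall j, m j <= n1)%N -> gap n1 <= `|mdot m l - l 0 i|.
Proof.
move=> m2 mn.
have nthm (j : 'I_n) : nth 0%N (codom m) j = m j.
  rewrite /codom /image_mem (nth_map j) ?size_enum_ord//.
  by rewrite nth_ord_enum.
have wm : weight (codom m) = mdeg m by apply: eq_bigr => j _.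
have sz : size (codom m) = n by rewrite size_codom card_ord.
apply: le_trans (gap_le sz _) _.
  by apply/allP => _ /codomP[j ->].
apply: le_trans (gap_base_le _ i) _; rewrite /divisor_or_one wm m2 ge_min.
apply/orP; right; rewrite le_eqVlt; apply/orP; left; apply/eqP; congr `|_ - _|.
by apply: eq_bigr => j _; rewrite nthm.
Qed.

Lemma gap_gt0 n1 : (forall i, l 0 i != 0) ->
  (forall (m : mindex n) i, (2 <= mdeg m)%N -> mdot m l - l 0 i != 0) ->
  0 < gap n1.
Proof.
move=> l0 ml0.
apply: (@nested_op_rel R unit (fun x _ => 0 < x) _ (fun _ _ => tt) _ (fun=> tt) _ _ _ [::]).
  by move=> x y _ _ x0 y0; rewrite lt_min x0.
move=> ms sz _; rewrite cats0.
apply/bigmin_gtP; split=> // i _; rewrite lt_min normr_gt0 l0 /= /divisor_or_one.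
case: ifP => // w2; pose m : mindex n := [ffun j : 'I_n => nth 0%N ms j].
have -> : \sum_(j < n) (nth 0%N ms j)%:R * l 0 j = mdot m l.
  by apply: eq_bigr => j _; rewrite ffunE.
rewrite normr_gt0 ml0//; rewrite (_ : mdeg m = weight ms)//.
by apply: eq_bigr => j _; rewrite ffunE.
Qed.

Definition abs_diff (a b : nat) := ((a - b) + (b - a))%N.

Lemma natr_abs_diff a b : (abs_diff a b)%:R = `|a%:R - b%:R| :> R.
Proof.
rewrite /abs_diff; have [ab|ba] := leqP a b.
  rewrite (eqP ab) add0n natrB// distrC ger0_norm// subr_ge0 ler_nat//.
have /eqP -> : (b - a == 0)%N by rewrite subn_eq0 ltnW.
rewrite addn0 natrB; last exact: ltnW.
by rewrite ger0_norm// subr_ge0 ler_nat; exact: ltnW.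
Qed.

(** The same expression as gap_base at the scale one, for integer approximations
with positive parts p and negative parts q. *)
Definition nat_gap_base (p q : 'I_n -> nat) (one : nat) s : nat :=
  \big[minn/one]_i minn (abs_diff (p i) (q i))
    (if (1 < weight s)%N then
       abs_diff (\sum_(j < n) nth 0 s j * p j + q i) (\sum_(j < n) nth 0 s j * q j + p i)
     else one)%N.

(** Integers y approximate reals x at the scale T, with an error E in units of the
scaled value; minima do not increase the error. *)
Definition scaled_approx (T E x : R) (y : nat) := `|x * T - y%:R| <= E.

Lemma scaled_approx_min T E x y x' y' : 0 <= T ->
  scaled_approx T E x x' -> scaled_approx T E y y' ->
  scaled_approx T E (Num.min x y) (minn x' y').
Proof.
rewrite /scaled_approx => T0 xx yy.
have -> : (minn x' y')%:R = Num.min x'%:R y'%:R :> R.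
  have [xy|yx] := leqP x' y'; first by rewrite min_l// ler_nat.
  by rewrite min_r// ler_nat ltnW.
rewrite minr_pMl//; move: xx yy; rewrite !ler_norml.
move=> /andP[? ?] /andP[? ?]; apply/andP; split.
  by case: (leP (x * T) (y * T)) => ?; case: (leP x'%:R y'%:R) => ?; lra.
by case: (leP (x * T) (y * T)) => ?; case: (leP x'%:R y'%:R) => ?; lra.
Qed.

Lemma nat_gap_base_approx (p q : 'I_n -> nat) (one n1 : nat) ms :
  (forall i, `|l 0 i * one%:R - ((p i)%:R - (q i)%:R)| <= 1) ->
  size ms = n -> all (fun m => m <= n1)%N ms ->
  scaled_approx one%:R (n * n1 + 1)%:R (gap_base ms) (nat_gap_base p q one ms).
Proof.
move=> lp sz msn.
have E0 : 1 <= (n * n1 + 1)%:R :> R by rewrite ler1n addn1.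
have one_approx : scaled_approx one%:R (n * n1 + 1)%:R 1 one.
  by rewrite /scaled_approx mul1r subrr normr0 (le_trans _ E0).
have abs_approx (x : R) (a b : nat) :
    `|x * one%:R - (a%:R - b%:R)| <= (n * n1 + 1)%:R ->
    scaled_approx one%:R (n * n1 + 1)%:R `|x| (abs_diff a b).
  move=> xab; rewrite /scaled_approx natr_abs_diff.
  rewrite -{1}(ger0_norm (ler0n R one)) -normrM.
  exact: le_trans (ler_dist_dist _ _) xab.
apply: (big_ind2 (scaled_approx one%:R (n * n1 + 1)%:R)) => //.
  by move=> *; exact: scaled_approx_min.
move=> i _; apply: scaled_approx_min => //.
  by apply: abs_approx; apply: le_trans (lp i) E0.
rewrite /divisor_or_one; case: ifP => // _; apply: abs_approx.
rewrite !natrD !natr_sum.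
rewrite [X in `|X|](_ : _ = \sum_(j < n) (nth 0%N ms j)%:R *
   (l 0 j * one%:R - ((p j)%:R - (q j)%:R)) - (l 0 i * one%:R - ((p i)%:R - (q i)%:R))); last first.
  have -> : \sum_(j < n) (nth 0%N ms j)%:R * (l 0 j * one%:R - ((p j)%:R - (q j)%:R)) =
    (\sum_(j < n) (nth 0%N ms j)%:R * l 0 j) * one%:R
    - (\sum_(j < n) (nth 0 ms j * p j)%N%:R - \sum_(j < n) (nth 0 ms j * q j)%N%:R).
    rewrite mulr_suml -!sumrB; apply: eq_bigr => j _; rewrite !natrM; ring.
  ring.
apply: le_trans (ler_normB _ _) _; rewrite lerD//.
apply: le_trans (ler_norm_sum _ _ _) _.
apply: (@le_trans _ _ (\sum_(j < n) n1%:R)); last first.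
  by rewrite sumr_const card_ord -mulrnA mulnC.
apply: ler_sum => j _; rewrite normrM -[leRHS]mulr1 ler_pM//.
rewrite ger0_norm// ler_nat; move/allP: msn; apply.
by rewrite mem_nth// sz.
Qed.

End Gap.

(** * Computation of the radius *)

Section RadiusProgram.

(** Positive and negative parts of the coded integer, so that natural number
arithmetic suffices. *)
Definition code_pos (a : nat) : nat := if odd a then 0 else a./2.
Definition code_neg (a : nat) : nat := if odd a then a./2.+1 else 0.

Lemma int_of_codeE (R : realType) a :
  (int_of_code a)%:~R = (code_pos a)%:R - (code_neg a)%:R :> R.
Proof.
rewrite /int_of_code /code_pos /code_neg; case: (odd a); last by rewrite subr0.
by rewrite sub0r NegzE mulrNz.
Qed.

Variable d : nat.

(** An integer combination with at most d coefficients, all at most n1, and one more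
term of coefficient one amplifies the error by d * n1 + 1 <= 2 ^ (d * n1 + 1). *)
Definition precision (n1 k : nat) : nat := (k + (d * n1 + 1))%N.

Definition entry_pos (O : oracle) off prec (i : nat) :=
  code_pos (O 0%N [:: (off + i)%N; prec]).
Definition entry_neg (O : oracle) off prec (i : nat) :=
  code_neg (O 0%N [:: (off + i)%N; prec]).

Definition oracle_gap_base (O : oracle) off n (s : seq nat) : nat :=
  let prec := precision (nth 0%N s n) (nth 0%N s n.+2) in
  nat_gap_base (fun i : 'I_n => entry_pos O off prec i)
    (fun i : 'I_n => entry_neg O off prec i) (2 ^ prec)%N s.

Definition oracle_gap (O : oracle) off n (s : seq nat) : nat :=
  nested_op minn (oracle_gap_base O off n) (nth 0%N s 0) n s.

(** The constant that makes the iteration for the formal solution preserve the ball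
of radius rho = 2 r. *)
Definition radius_denominator (B : nat) : nat := (d * 2 ^ d.+4.+1 * (B.+1 * B.+1))%N.

(** The quotient of g by D is rounded to the nearest integer, which leaves half a
unit for the error in g; the factor 2 turns a natural number into its code as an
integer. *)
Definition radius_code (ds du : nat) (O : oracle) (s : seq nat) : nat :=
  let g := minn (oracle_gap O 0 ds s) (oracle_gap O ds du s) in
  let D := (radius_denominator (nth 0 s 1) * 2 ^ (d * nth 0 s 0 + 1))%N in
  (2 * ((2 * g + D) %/ (2 * D)))%N.

Lemma computable_code_pos L f : computable L f ->
  computable L (fun O s => code_pos (f O s)).
Proof.
move=> fc; have := computable_if_pos (computable_odd fc)
  (computable_const L 0) (computable_half fc).
by apply: computable_ext => O s _; rewrite /code_pos; case: (odd _).
Qed.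

Lemma computable_code_neg L f : computable L f ->
  computable L (fun O s => code_neg (f O s)).
Proof.
move=> fc; have := computable_if_pos (computable_odd fc)
  (computable_succ (computable_half fc)) (computable_const L 0).
by apply: computable_ext => O s _; rewrite /code_neg; case: (odd _).
Qed.

Lemma computable_sum L n (F : 'I_n -> oracle -> seq nat -> nat) :
  (forall i, computable L (F i)) -> computable L (fun O s => \sum_i F i O s)%N.
Proof.
move=> Fc; apply: (@computable_big L addn _ _ F (fun=> fun=> 0%N)) => //.
  by move=> g h; exact: computable_add.
exact: computable_const.
Qed.

Lemma computable_abs_diff L f g : computable L f -> computable L g ->
  computable L (fun O s => abs_diff (f O s) (g O s)).
Proof. by move=> fc gc; apply: computable_add; apply: computable_sub. Qed.

Lemma computable_precision L i j :
  computable L (fun O s => precision (nth 0%N s i) (nth 0%N s j)).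
Proof.
apply: computable_add; first exact: computable_proj.
apply: computable_add; last exact: computable_const.
by apply: computable_mul; [exact: computable_const|exact: computable_proj].
Qed.

Lemma computable_oracle_gap_base off n :
  computable (n + 3) (fun O s => oracle_gap_base O off n s).
Proof.
have precc := computable_precision (n + 3) n n.+2.
have entry (i : 'I_n) : computable (n + 3) (fun O s =>
    O 0%N [:: (off + i)%N; precision (nth 0%N s n) (nth 0%N s n.+2)]).
  by apply: computable_oracle; [exact: computable_const|exact: precc].
have posc i := computable_code_pos (entry i).
have negc i := computable_code_neg (entry i).
apply: (@computable_big _ minn).
- by move=> g h; exact: computable_min.
- exact: computable_pow2.
move=> i; apply: computable_min; first exact: (computable_abs_diff (posc i) (negc i)).
have wc : computable (n + 3) (fun O s => weight n s).
  by apply: computable_sum => j; exact: computable_proj.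
have := computable_if_pos (computable_sub wc (computable_const _ 1))
  (computable_abs_diff
    (computable_add (computable_sum (fun j : 'I_n =>
       computable_mul (computable_proj _ j) (posc j))) (negc i))
    (computable_add (computable_sum (fun j : 'I_n =>
       computable_mul (computable_proj _ j) (negc j))) (posc i)))
  (computable_pow2 precc).
by apply: computable_ext => O s _; rewrite subn_gt0.
Qed.

Lemma computable_oracle_gap off n : computable 3 (fun O s => oracle_gap O off n s).
Proof.
apply: (@computable_nested_min n 3 (fun O s => nth 0%N s 0)
          (fun O s => oracle_gap_base O off n s)).
  exact: computable_proj.
exact: computable_oracle_gap_base.
Qed.

Hypothesis d0 : (0 < d)%N.

Lemma radius_denominator_gt1 B : (1 < radius_denominator B)%N.
Proof.
rewrite /radius_denominator; apply: (@leq_trans (1 * 2 * (1 * 1))%N) => //.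
rewrite !leq_mul// expnS -[X in (X <= _)%N]muln1 leq_mul// expn_gt0//.
Qed.

Lemma computable_radius_code ds du : computable 3 (radius_code ds du).
Proof.
pose g (O : oracle) s := minn (oracle_gap O 0 ds s) (oracle_gap O ds du s).
have gc : computable 3 g.
  by apply: computable_min; exact: computable_oracle_gap.
pose D (O : oracle) s := (radius_denominator (nth 0 s 1) * 2 ^ (d * nth 0 s 0 + 1))%N.
have Dc : computable 3 D.
  apply: computable_mul.
    apply: computable_mul; first exact: computable_const.
    by apply: computable_mul; exact: (computable_succ (computable_proj 3 1)).
  apply: computable_pow2; apply: computable_add; last exact: computable_const.
  by apply: computable_mul; [exact: computable_const|exact: computable_proj].
have c2 := computable_const 3 2.
apply: computable_mul => //; apply: (@computable_div 3
  (fun O s => 2 * g O s + D O s)%N (fun O s => 2 * D O s)%N).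
- by apply: computable_add => //; exact: computable_mul.
- exact: computable_mul.
move=> O s _; rewrite muln_gt0 /D muln_gt0 expn_gt0 andbT andTb.
exact: (ltnW (radius_denominator_gt1 _)).
Qed.

Variable R : realType.

(** The radius is defined from the eigenvalues alone; the oracle is only one of their
many descriptions. *)
Lemma radius_code_correct ds du (lam : 'rV[R]_ds) (mu : 'rV[R]_du)
    (O : oracle) n1 B k :
  d = (ds + du)%N ->
  (forall (i : 'I_(ds + du)) k, approx k (O 0%N [:: nat_of_ord i; k]) (row_mx lam mu 0 i)) ->
  approx k (radius_code ds du O [:: n1; B; k])
    (Num.min (gap lam n1) (gap mu n1) / (radius_denominator B)%:R).
Proof.
move=> dE Oapprox.
pose prec := precision n1 k; pose T : R := (2 ^ prec)%N%:R.
have T0 : 0 < T by rewrite ltr0n expn_gt0.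
pose E : R := (d * n1 + 1)%:R.
have gap_approx n off (l : 'rV[R]_n) : (n <= d)%N ->
    (forall i : 'I_n, approx prec (O 0%N [:: (off + i)%N; prec]) (l 0 i)) ->
    scaled_approx T E (gap l n1) (oracle_gap O off n [:: n1; B; k]).
  move=> nd lO; apply: (@nested_op_rel _ _ (scaled_approx T E)).
    by move=> *; apply: scaled_approx_min => //; exact: ltW.
  move=> ms sz msn; rewrite cats0.
  have -> : oracle_gap_base O off n (ms ++ [:: n1; B; k]) =
      nat_gap_base (fun i : 'I_n => entry_pos O off prec i)
        (fun i : 'I_n => entry_neg O off prec i) (2 ^ prec)%N ms.
    rewrite /oracle_gap_base !nth_cat sz ltnn subnn ltnNge -addn2 leq_addr /= addnC addnK /=.
    have nthE (j : 'I_n) : nth 0%N (ms ++ [:: n1; B; k]) j = nth 0%N ms j.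
      by rewrite nth_cat sz ltn_ord.
    have wE : weight n (ms ++ [:: n1; B; k]) = weight n ms.
      by apply: eq_bigr => j _; rewrite nthE.
    rewrite /nat_gap_base wE; apply: eq_bigr => i _; congr minn; case: ifP => // _.
    by congr abs_diff; congr addn; apply: eq_bigr => j _; rewrite nthE.
  have := @nat_gap_base_approx R n l (fun i : 'I_n => entry_pos O off prec i)
    (fun i : 'I_n => entry_neg O off prec i) (2 ^ prec)%N n1 ms _ sz msn.
  rewrite /scaled_approx -/T => H; apply: le_trans (H _) _; last first.
    by rewrite ler_nat leq_add2r leq_mul2r nd orbT.
  move=> i; have := lO i; rewrite /approx int_of_codeE -natrX -/T => li.
  have -> : l 0 i * T - ((entry_pos O off prec i)%:R - (entry_neg O off prec i)%:R)
    = (l 0 i - ((entry_pos O off prec i)%:R - (entry_neg O off prec i)%:R) / T) * T.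
    by field; rewrite gt_eqF.
  by rewrite normrM (gtr0_norm T0) -ler_pdivlMr// mul1r.
have lamO (i : 'I_ds) : approx prec (O 0%N [:: (0 + i)%N; prec]) (lam 0 i).
  by have := Oapprox (lshift du i) prec; rewrite row_mxEl.
have muO (i : 'I_du) : approx prec (O 0%N [:: (ds + i)%N; prec]) (mu 0 i).
  by have := Oapprox (rshift ds i) prec; rewrite row_mxEr.
have := scaled_approx_min (ltW T0)
  (gap_approx _ 0%N lam _ lamO) (gap_approx _ ds mu _ muO).
rewrite dE leq_addr leq_addl => /(_ isT isT).
rewrite /radius_code /=; set g := minn _ _; set gam := Num.min _ _.
set C := radius_denominator B; set D := (C * _)%N.
rewrite /scaled_approx => gamg.
have C2 : 2 <= C%:R :> R by rewrite ler_nat radius_denominator_gt1.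
have D0 : (0 < D)%N.
  by rewrite muln_gt0 expn_gt0 andbT ltnW// radius_denominator_gt1.
have DE : D%:R = C%:R * 2 ^+ (d * n1 + 1) :> R by rewrite natrM natrX.
have TE : T = 2 ^+ k * 2 ^+ (d * n1 + 1) by rewrite /T natrX /prec /precision exprD.
have E2 : E <= 2 ^+ (d * n1 + 1) by exact: nat_le_pow2.
set v := (_ %/ _)%N.
(* v is g / D rounded to the nearest integer. *)
have vle : (v * (2 * D) <= 2 * g + D)%N by exact: leq_divM.
have vgt : (2 * g + D < v.+1 * (2 * D))%N by apply: ltn_ceil; rewrite muln_gt0.
rewrite /approx (_ : int_of_code (2 * v) = Posz v); last first.
  by rewrite /int_of_code mul2n odd_double doubleK.
have {}vle : v%:R * (2 * D%:R) <= 2 * g%:R + D%:R :> R.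
  by rewrite -!natrM -natrD ler_nat.
have {}vgt : 2 * g%:R + D%:R < (v%:R + 1) * (2 * D%:R) :> R.
  by rewrite natr1 -!natrM -natrD ltr_nat.
clearbody v g; clearbody D; clearbody C gam.
rewrite -pmulrn; move: vle vgt gamg; rewrite DE TE.
have a0 : 0 < 2 ^+ k :> R by rewrite exprn_gt0.
have e0 : 0 < 2 ^+ (d * n1 + 1) :> R by rewrite exprn_gt0.
move: (2 ^+ k : R) (2 ^+ (d * n1 + 1) : R) (C%:R : R) (v%:R : R) (g%:R : R) a0 e0 C2 E2.
move=> a e c v' g' a0 e0 c2 Ee vle vgt gamg.
have c0 : 0 < c by lra.
have ce : e <= c * e / 2 by rewrite ler_pdivlMr// mulrC ler_pM2r.
have -> : gam / c - v' / a = (gam * (a * e) - v' * (c * e)) / (a * (c * e)).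
  by field; rewrite !gt_eqF.
have ace0 : 0 < a * (c * e) by rewrite !mulr_gt0.
rewrite normrM normfV (gtr0_norm ace0) ler_pdivrMr// mulKf ?gt_eqF//.
move: gamg vle vgt; rewrite !ler_norml => /andP[].
rewrite !(mulrCA _ 2%:R) mulrDl mul1r.
move: (gam * (a * e)) (v' * (c * e)) (c * e) ce => x w y ce.
by move=> *; apply/andP; split; lra.
Qed.

End RadiusProgram.

(** * Bounds on coefficients and divisors, and time reversal *)

Section CoefficientBound.
Variables (R : realType) (d : nat).

(** The sum is dominated by a product of d geometric series. *)
Lemma half_power_sum (N : nat) : \sum_(m <- multis d N) 2^-1 ^+ mdeg m <= 2 ^+ d :> R.
Proof.
have h0 : 0 <= 2^-1 :> R by rewrite invr_ge0.
have geom K : \sum_(j < K) 2^-1 ^+ j <= 2 :> R.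
  suff -> : \sum_(j < K) 2^-1 ^+ j = 2 - 2 * 2^-1 ^+ K :> R.
    by rewrite gerBl mulr_ge0// exprn_ge0.
  elim: K => [|K IH]; first by rewrite big_ord0 expr0 mulr1 subrr.
  by rewrite big_ord_recr/= IH exprS; field.
rewrite big_filter big_map /=.
apply: (@le_trans _ _ (\sum_(f : {ffun 'I_d -> 'I_N.+1}) \prod_i 2^-1 ^+ f i)).
  rewrite big_enum_cond/= [leRHS](bigID (fun f : {ffun 'I_d -> 'I_N.+1} =>
    (mdeg [ffun i => val (f i)] <= N)%N))/=.
  rewrite -[leLHS]addr0; apply: lerD; last first.
    by apply: sumr_ge0 => f _; apply: prodr_ge0 => i _; rewrite exprn_ge0.
  apply: ler_sum => f _; rewrite /mdeg -prodrXr.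
  by rewrite le_eqVlt; apply/orP; left; apply/eqP; apply: eq_bigr => i _; rewrite ffunE.
rewrite -(bigA_distr_bigA (fun (_ : 'I_d) (j : 'I_N.+1) => 2^-1 ^+ j)).
rewrite -[leRHS](_ : \prod_(i < d) 2 = _); last by rewrite prodr_const card_ord.
by apply: ler_prod => i _; rewrite geom sumr_ge0// => j _; rewrite exprn_ge0.
Qed.

(** With t = 4 rho (B + 1) <= 1, each term of degree k >= 2 is at most
(t / 2)^k <= t^2 2^-k, and the powers of 1/2 sum to at most 2^d. *)
Lemma coef_bound_sum (c : mindex d -> 'rV[R]_d) B gam rho :
  (0 < d)%N -> no_low_terms c -> coef_bound c B -> 0 < gam -> gam <= 1 ->
  rho = gam / (d%:R * 2 ^+ d.+4 * (B.+1%:R * B.+1%:R)) ->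
  coef_sum_le c (2 * rho) (gam * rho / d%:R).
Proof.
move=> d0 c0 cB gam0 gam1 rhoE N.
have dR : 0 < d%:R :> R by rewrite ltr0n.
have bR : 0 < B.+1%:R :> R by rewrite ltr0n.
have pR : 0 < 2 ^+ d :> R by rewrite exprn_gt0.
have den0 : 0 < d%:R * 2 ^+ d.+4 * (B.+1%:R * B.+1%:R) :> R.
  by apply: mulr_gt0; apply: mulr_gt0 => //; rewrite exprn_gt0.
have rho0 : 0 < rho by rewrite rhoE divr_gt0.
pose t := 4 * rho * B.+1%:R.
have t0 : 0 <= t by rewrite !mulr_ge0// ltW.
have t1 : t <= 1.
  have denE : d%:R * 2 ^+ d.+4 * (B.+1%:R * B.+1%:R) =
      (d * 2 ^ d.+4 * (B.+1 * B.+1))%N%:R :> R.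
    by rewrite natrM (natrM _ d) natrX (natrM _ B.+1).
  rewrite /t rhoE [leLHS](_ : _ = gam * (4 * B.+1%:R)
    / (d%:R * 2 ^+ d.+4 * (B.+1%:R * B.+1%:R))); last by ring.
  rewrite ler_pdivrMr// mul1r.
  apply: (@le_trans _ _ (4 * B.+1%:R)); first by rewrite ler_piMl// mulr_ge0.
  rewrite denE -(natrM _ 4 B.+1) ler_nat.
  apply: (@leq_trans (1 * 4 * (1 * B.+1))%N); first by rewrite !mul1n.
  rewrite !leq_mul// (_ : 4 = 2 ^ 2)%N// leq_exp2l//.
apply: (@le_trans _ _ (\sum_(m <- multis d N) t ^+ 2 * 2^-1 ^+ mdeg m)).
  apply: ler_sum => m _; have [m2|m2] := ltnP (mdeg m) 2.
    by rewrite c0// normr0 mul0r mulr_ge0// exprn_ge0// invr_ge0.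
  apply: (@le_trans _ _ ((t * 2^-1) ^+ mdeg m)).
    apply: (@le_trans _ _ ((B.+1%:R * (2 * rho)) ^+ mdeg m)).
      rewrite [leRHS]exprMn ler_wpM2r ?exprn_ge0 ?mulr_ge0 ?(ltW rho0)//.
      apply: le_trans (cB m) _; rewrite lerXn2r ?nnegrE// ler_nat//.
    have -> : B.+1%:R * (2 * rho) = t * 2^-1 by rewrite /t; field.
    exact: lexx.
  by rewrite exprMn ler_wpM2r ?exprn_ge0 ?invr_ge0// ler_wiXn2l.
rewrite -mulr_sumr; apply: le_trans (ler_wpM2l _ (half_power_sum N)) _.
  by rewrite exprn_ge0.
rewrite le_eqVlt; apply/orP; left; apply/eqP.
have p4 : 2 ^+ d.+4 = 16 * 2 ^+ d :> R by rewrite !exprS; ring.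
rewrite /t rhoE p4; move: (2 ^+ d) pR => p p0.
by field; rewrite !gt_eqF.
Qed.

End CoefficientBound.

Section DivisorBound.
Variables (R : realType) (n : nat) (lam : 'rV[R]_n) (n1 : nat) (tau : R).
Hypotheses (tau0 : 0 < tau) (lam_le : forall i, lam 0 i <= - tau).
Hypothesis lam_ge : forall i, - (n1%:R * tau) <= lam 0 i.

Lemma mdot_le (m : mindex n) : mdot m lam <= - ((mdeg m)%:R * tau).
Proof.
rewrite /mdot /mdeg natr_sum mulr_suml -sumrN; apply: ler_sum => i _.
by rewrite -mulrN ler_wpM2l.
Qed.

Lemma gap_le_tau (i : 'I_n) : lam 0 i = - tau -> gap lam n1 <= tau.
Proof.
move=> li; apply: le_trans (gap_le_norm _ n1 i) _.
by rewrite li normrN ger0_norm// ltW.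
Qed.

Hypothesis gap_tau : gap lam n1 <= tau.

(** If some exponent exceeds n1, then m.lam <= - (n1 + 1) tau, which is below every
eigenvalue by at least tau. *)
Lemma gap_le_stable_divisor (m : mindex n) i : (2 <= mdeg m)%N ->
  gap lam n1 <= `|mdot m lam - lam 0 i|.
Proof.
move=> m2; case: (boolP [forall j, m j <= n1]%N) => [/forallP|]; last first.
  rewrite negb_forall => /existsP[j]; rewrite -ltnNge => mj.
  have mn : (n1 < mdeg m)%N by apply: leq_trans mj _; rewrite /mdeg (bigD1 j)//= leq_addr.
  apply: le_trans gap_tau _; rewrite ler_normr; apply/orP; right.
  have := mdot_le m; have := lam_ge i.
  have : n1.+1%:R * tau <= (mdeg m)%:R * tau by rewrite ler_pM2r// ler_nat.
  rewrite -natr1 mulrDl mul1r; lra.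
exact: gap_le_divisor.
Qed.

Lemma gap_le_unstable_divisor (m : mindex n) x : (2 <= mdeg m)%N -> 0 <= x ->
  gap lam n1 <= `|mdot m lam - x|.
Proof.
move=> m2 x0; apply: le_trans gap_tau _; rewrite ler_normr; apply/orP; right.
have := mdot_le m.
have : 2%:R * tau <= (mdeg m)%:R * tau by rewrite ler_pM2r// ler_nat.
by move: tau0 x0; lra.
Qed.

End DivisorBound.

Lemma gapN (R : realType) n (l : 'rV[R]_n) n1 : gap (- l) n1 = gap l n1.
Proof.
rewrite /gap; congr nested_op; apply/funext => s; apply: eq_bigr => i _.
rewrite mxE normrN /divisor_or_one; congr Num.min; case: ifP => // _.
rewrite -[RHS]normrN opprB addrC mxE opprK; congr `|_ + _|.
by rewrite -sumrN; apply: eq_bigr => j _; rewrite mxE mulrN.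
Qed.

Section TimeReversal.
Variables (R : realType) (d : nat).
Implicit Types (X F : 'rV[R]_d -> 'rV[R]_d).

Lemma is_derive_reverse (u : R -> 'rV[R]_d) (t : R) du :
  is_derive (- t) 1 u du -> is_derive t 1 (fun s => u (- s)) (- du).
Proof.
move=> udu; apply: is_derive_row => j.
have uj := is_derive_coord j udu.
have := @is_derive1_comp R (fun s => u s 0 j) -%R t (du 0 j) (-1) uj _.
by rewrite mulrN1 mxE; apply.
Qed.

Lemma local_unstable_set_reverse X N :
  local_unstable_set X N = local_stable_set (fun z => - X z) N.
Proof.
have rev t : 0 <= t -> - t <= 0 :> R by rewrite oppr_le0.
have rev' t : t <= 0 -> 0 <= - t :> R by rewrite oppr_ge0.
apply/seteqP; split=> z [u [u0 du uN ulim]]; exists (fun t => u (- t)); split.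
- by rewrite oppr0.
- by move=> t t0; apply: is_derive_reverse; apply: du; exact: rev.
- by move=> t t0; apply: uN; exact: rev.
- by apply/cvgy_compNP; under eq_fun do rewrite /= opprK.
- by rewrite oppr0.
- move=> t t0; rewrite -[X _]opprK; apply: is_derive_reverse.
  by apply: du; exact: rev'.
- by move=> t t0; apply: uN; exact: rev'.
- by apply/cvgNy_compNP; under eq_fun do rewrite /= opprK.
Qed.

Lemma pseries_cvgN n (a : mindex n -> 'rV[R]_d) x v :
  pseries_cvg a x v -> pseries_cvg (fun m => - a m) x (- v).
Proof.
move=> [sa ca]; split.
  by under eq_esum do rewrite scalerN normrN.
rewrite (_ : (fun N : nat => _) = (fun N => - psum a N x)); last first.
  apply/funext => N; rewrite psum_fsbig /psum -sumrN.
  by apply: eq_bigr => m _; rewrite scalerN.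
apply: cvgN; move: ca; rewrite (_ : (fun N : nat => _) = (fun N => psum a N x))//.
by apply/funext => N; rewrite psum_fsbig.
Qed.

End TimeReversal.

(** * The change of variables and the theorem *)

Section ThetaDerivative.
Variables (R : realType) (ds du : nat).
Variables (phi : 'rV[R]_ds -> 'rV[R]_(ds + du)) (psi : 'rV[R]_du -> 'rV[R]_(ds + du)).

Lemma norm_lsubmx (z : 'rV[R]_(ds + du)) : `|lsubmx z| <= `|z|.
Proof. by apply: norm_le_coord => // i; rewrite mxE norm_coord. Qed.

Lemma norm_rsubmx (z : 'rV[R]_(ds + du)) : `|rsubmx z| <= `|z|.
Proof. by apply: norm_le_coord => // i; rewrite mxE norm_coord. Qed.

Variables (Js : 'M[R]_(ds, ds + du)) (Ju : 'M[R]_(du, ds + du)).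

Lemma mulmx_Theta_jacobian (v : 'rV[R]_(ds + du)) :
  v *m (1%:M + col_mx Js Ju) = v + (lsubmx v *m Js + rsubmx v *m Ju).
Proof. by rewrite mulmxDr mulmx1 -{2}(hsubmxK v) mul_row_col. Qed.

Lemma Theta_differentiable (z : 'rV[R]_(ds + du)) (K1 K2 delta : R) : 0 < delta ->
  (forall h : 'rV[R]_ds, `|h| < delta ->
     `|phi (h + lsubmx z) - phi (lsubmx z) - h *m Js| <= K1 * `|h| ^+ 2) ->
  (forall h : 'rV[R]_du, `|h| < delta ->
     `|psi (h + rsubmx z) - psi (rsubmx z) - h *m Ju| <= K2 * `|h| ^+ 2) ->
  differentiable (Theta phi psi) z /\
  jacobian (Theta phi psi) z = 1%:M + col_mx Js Ju.
Proof.
move=> delta0 phiP psiP.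
apply: (@quadratic_jacobian _ _ _ _ _ _ (`|K1| + `|K2|) delta) => // h hd.
have hl : lsubmx (h + z) = lsubmx h + lsubmx z by apply/rowP => i; rewrite !mxE.
have hr : rsubmx (h + z) = rsubmx h + rsubmx z by apply/rowP => i; rewrite !mxE.
rewrite mulmx_Theta_jacobian /Theta hl hr.
have -> : h + z + phi (lsubmx h + lsubmx z) + psi (rsubmx h + rsubmx z) -
    (z + phi (lsubmx z) + psi (rsubmx z)) -
    (h + (lsubmx h *m Js + rsubmx h *m Ju)) =
  (phi (lsubmx h + lsubmx z) - phi (lsubmx z) - lsubmx h *m Js) +
  (psi (rsubmx h + rsubmx z) - psi (rsubmx z) - rsubmx h *m Ju).
  move: (phi _) (phi _) (psi _) (psi _) (lsubmx h *m Js) (rsubmx h *m Ju).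
  by move=> A B C D E F; apply/rowP => i; rewrite !mxE; ring.
apply: le_trans (ler_normD _ _) _; rewrite mulrDl lerD//.
  apply: le_trans (phiP _ (le_lt_trans (norm_lsubmx h) hd)) _.
  apply: (@le_trans _ _ (`|K1| * `|lsubmx h| ^+ 2)).
    by rewrite ler_wpM2r ?exprn_ge0// ler_norm.
  by rewrite ler_wpM2l// lerXn2r ?nnegrE// norm_lsubmx.
apply: le_trans (psiP _ (le_lt_trans (norm_rsubmx h) hd)) _.
apply: (@le_trans _ _ (`|K2| * `|rsubmx h| ^+ 2)).
  by rewrite ler_wpM2r ?exprn_ge0// ler_norm.
by rewrite ler_wpM2l// lerXn2r ?nnegrE// norm_rsubmx.
Qed.

(** The matrix is within 1/2 of the identity in operator norm, hence injective. *)
Lemma Theta_jacobian_unit :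
  (forall h : 'rV[R]_ds, `|h *m Js| <= 4^-1 * `|h|) ->
  (forall h : 'rV[R]_du, `|h *m Ju| <= 4^-1 * `|h|) ->
  1%:M + col_mx Js Ju \in unitmx.
Proof.
move=> Jsle Jule; rewrite -row_free_unit; apply: inj_row_free => v.
rewrite mulmx_Theta_jacobian => /eqP; rewrite addr_eq0 => /eqP vE.
apply/eqP; rewrite -normr_le0.
have : `|v| <= `|lsubmx v *m Js| + `|rsubmx v *m Ju|.
  by rewrite {1}vE normrN ler_normD.
have := Jsle (lsubmx v); have := Jule (rsubmx v).
by have := norm_lsubmx v; have := norm_rsubmx v; lra.
Qed.

End ThetaDerivative.

Lemma strict_ceil_lt (R : realType) (x : R) (n : nat) :
  strict_ceil x <= n%:Z -> x < n%:R.
Proof.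
move=> xn; apply: lt_le_trans (floorD1_gt x) _.
by rewrite -[leRHS]/(n%:Z%:~R) ler_int.
Qed.

Section Splitting.
Variables (R : realType) (ds du : nat).

Definition stable_index (j : 'I_(ds + du)) : option 'I_ds :=
  if fintype.split j is inl i then Some i else None.

Definition unstable_index (j : 'I_(ds + du)) : option 'I_du :=
  if fintype.split j is inr i then Some i else None.

Lemma stable_indexE j i : (stable_index j == Some i) = (lshift du i == j).
Proof.
rewrite /stable_index; case: split_ordP => i' ->.
  by rewrite (inj_eq (@Some_inj _)) eq_lshift eq_sym.
by rewrite eq_lrshift.
Qed.

Lemma unstable_indexE j i : (unstable_index j == Some i) = (rshift ds i == j).
Proof.
rewrite /unstable_index; case: split_ordP => i' ->.
  by rewrite eq_rlshift.
by rewrite (inj_eq (@Some_inj _)) eq_rshift eq_sym.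
Qed.

Lemma emb_stable (x : 'rV[R]_ds) : emb stable_index x = embed_s du x.
Proof.
apply/rowP => j; rewrite mxE /stable_index /embed_s; case: split_ordP => i ->.
  by rewrite row_mxEl.
by rewrite row_mxEr mxE.
Qed.

Lemma emb_unstable (x : 'rV[R]_du) : emb unstable_index x = embed_u ds x.
Proof.
apply/rowP => j; rewrite mxE /unstable_index /embed_u; case: split_ordP => i ->.
  by rewrite row_mxEl mxE.
by rewrite row_mxEr.
Qed.

End Splitting.

Theorem theorem2p2 (R : realType) (ds du : nat) :
  exists e : recfun,
  forall (lam : 'rV[R]_ds.+1) (mu : 'rV[R]_du.+1)
    (c : mindex (ds.+1 + du.+1) -> 'rV[R]_(ds.+1 + du.+1))
    (F : 'rV[R]_(ds.+1 + du.+1) -> 'rV[R]_(ds.+1 + du.+1))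
    (n1 B : nat),
  in_F lam mu ->
  no_low_terms c -> analytic_at_origin c F -> coef_bound c B ->
  Num.max (strict_ceil (lam 0 ord0 / lam 0 ord_max))
          (strict_ceil (mu 0 ord_max / mu 0 ord0)) <= n1%:Z ->
  exists (r : R)
    (alpha : mindex ds.+1 -> 'rV[R]_(ds.+1 + du.+1))
    (beta : mindex du.+1 -> 'rV[R]_(ds.+1 + du.+1))
    (phi : 'rV[R]_ds.+1 -> 'rV[R]_(ds.+1 + du.+1))
    (psi : 'rV[R]_du.+1 -> 'rV[R]_(ds.+1 + du.+1)),
  let X := vfield (Lambda lam mu) F in
  (0 < r /\ computes_from_data e (row_mx lam mu) c n1 B r) /\
  ([/\ no_low_terms alpha, no_low_terms beta,
       forall xi, `|xi| < r -> pseries_cvg alpha xi (phi xi)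
     & forall eta, `|eta| < r -> pseries_cvg beta eta (psi eta)]) /\
  ([/\ parametrises (fun xi => embed_s du.+1 xi + phi xi) (disc r)
         (local_stable_set X),
       parametrises (fun eta => embed_u ds.+1 eta + psi eta) (disc r)
         (local_unstable_set X)
     & exists G : 'rV[R]_(ds.+1 + du.+1) -> 'rV[R]_(ds.+1 + du.+1),
         \forall zeta \near (0 : 'rV[R]_(ds.+1 + du.+1)),
           [/\ differentiable (Theta phi psi) zeta,
               jacobian (Theta phi psi) zeta \in unitmx,
               pullback (Theta phi psi) X zeta
                 = vfield (Lambda lam mu) G zeta,
               @Es R ds.+1 du.+1 zeta -> G zeta = 0
             & @Eu R ds.+1 du.+1 zeta -> G zeta = 0]]) /\
  ((forall xi, `|xi| < r ->
      scale_set (r * (`|xi| / r) ^+ n1.+1 * (1 - `|xi| / r)^-1)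
        (disc 1) (phi xi - taylor_part alpha n1 xi)) /\
   (forall eta, `|eta| < r ->
      scale_set (r * (`|eta| / r) ^+ n1.+1 * (1 - `|eta| / r)^-1)
        (disc 1) (psi eta - taylor_part beta n1 eta))).
Proof.
pose d := (ds.+1 + du.+1)%N.
have d0 : (0 < d)%N by [].
have [e eP] := @computable_radius_code d d0 ds.+1 du.+1.
exists e => lam mu c F n1 B.
move=> [[[lam_mono lam_neg mu_pos mu_mono] nonres_s] [_ nonres_u]] c0 cF cB.
rewrite ge_max => /andP[/strict_ceil_lt n1_s /strict_ceil_lt n1_u].
pose l := row_mx lam mu.
pose gam := Num.min (gap lam n1) (gap mu n1).
pose r := gam / (radius_denominator d B)%:R.
have lam_neq0 i : lam 0 i != 0 by rewrite lt_eqF.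
have mu_neq0 i : mu 0 i != 0 by rewrite gt_eqF.
have mdeg0 n : mdeg ([ffun=> 0%N] : mindex n) = 0%N.
  by rewrite /mdeg big1// => i _; rewrite ffunE.
(* A multi-index with one zero half is admissible for the other half. *)
have gam0 : 0 < gam.
  rewrite lt_min; apply/andP; split; apply: gap_gt0 => // m i m2; apply/eqP.
    by apply: (nonres_s m [ffun=> 0%N]); split; [rewrite mdeg0 addn0|right].
  by apply: (nonres_u [ffun=> 0%N] m); split; [rewrite mdeg0|left].
have gam1 : gam <= 1 by rewrite ge_min gap_le1.
have den0 : 0 < (radius_denominator d B)%:R :> R.
  by rewrite ltr0n ltnW// radius_denominator_gt1.
have r0 : 0 < r by rewrite divr_gt0.
pose rho := 2 * r; have rho0 : 0 < rho by rewrite mulr_gt0.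
have rhoE : rho / 2 = r by rewrite /rho mulrAC divff// mul1r.
have c_bound : coef_sum_le c (2 * rho) (gam * rho / d%:R).
  apply: (coef_bound_sum d0 c0 cB gam0 gam1).
  have dR : d%:R != 0 :> R by rewrite pnatr_eq0.
  have BR : B.+1%:R != 0 :> R by rewrite pnatr_eq0.
  have pR : 2 ^+ d.+4 != 0 :> R by rewrite expf_neq0.
  rewrite /rho /r /radius_denominator natrM (natrM _ d) natrX (natrM _ B.+1) (exprS 2 d.+4).
  move: (2 ^+ d.+4) pR (B.+1%:R : R) BR (d%:R : R) dR => p p0 b b0 d' d'0.
  by field; rewrite p0 b0 d'0.
pose tau_s := - lam 0 ord_max; pose tau_u := mu 0 ord0.
have tau_s0 : 0 < tau_s by rewrite oppr_gt0.
have tau_u0 : 0 < tau_u by exact: mu_pos.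
have lam_le i : lam 0 i <= - tau_s by rewrite opprK lam_mono// -ltnS ltn_ord.
have lam_ge i : - (n1%:R * tau_s) <= lam 0 i.
  apply: le_trans (_ : _ <= lam 0 ord0) _; last exact: lam_mono.
  by rewrite mulrN opprK; apply: ltW; rewrite -ltr_ndivrMr.
have gap_s : gap lam n1 <= tau_s.
  by apply: (@gap_le_tau _ _ _ _ _ tau_s0 ord_max); rewrite opprK.
have mu_le i : (- mu) 0 i <= - tau_u by rewrite mxE lerN2 mu_mono.
have mu_ge i : - (n1%:R * tau_u) <= (- mu) 0 i.
  rewrite mxE lerN2; apply: (@le_trans _ _ (mu 0 ord_max)).
    by rewrite mu_mono// -ltnS ltn_ord.
  by apply: ltW; rewrite -ltr_pdivrMr.
have gap_u : gap (- mu) n1 <= tau_u.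
  by apply: (@gap_le_tau _ _ _ _ _ tau_u0 ord0); rewrite mxE.
have lamE : \row_i l 0 (lshift du.+1 i) = lam.
  by apply/rowP => i; rewrite mxE row_mxEl.
have muE : \row_i (- l) 0 (rshift ds.+1 i) = - mu.
  by apply/rowP => i; rewrite [LHS]mxE [LHS]mxE row_mxEr [RHS]mxE.
have gam_s : gam <= gap lam n1 by rewrite ge_min lexx.
have gam_u : gam <= gap (- mu) n1 by rewrite gapN ge_min lexx orbT.
have div_s (m : mindex ds.+1) i : (2 <= mdeg m)%N ->
    gam <= `|divisor (\row_i l 0 (lshift du.+1 i)) l m i|.
  move=> m2; apply: le_trans gam_s _; rewrite /divisor lamE /l.
  case: (split_ordP i) => j ->; rewrite ?row_mxEl ?row_mxEr.
    exact: (gap_le_stable_divisor tau_s0).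
  by apply: (gap_le_unstable_divisor tau_s0) => //; exact: ltW.
have div_u (m : mindex du.+1) i : (2 <= mdeg m)%N ->
    gam <= `|divisor (\row_i (- l) 0 (rshift ds.+1 i)) (- l) m i|.
  move=> m2; apply: le_trans gam_u _; rewrite /divisor muE /l.
  rewrite [(- row_mx _ _) 0 i]mxE; case: (split_ordP i) => j ->; rewrite ?row_mxEl ?row_mxEr.
    by apply: (gap_le_unstable_divisor tau_u0) => //; rewrite oppr_ge0 ltW.
  rewrite (_ : - mu 0 j = (- mu) 0 j); last by rewrite mxE.
  exact: (gap_le_stable_divisor tau_u0).
have l_s i : l 0 (lshift du.+1 i) <= - gam.
  by rewrite row_mxEl; apply: le_trans (lam_le i) _; rewrite lerN2 (le_trans gam_s).
have l_s' j : unstable_index j = None -> gam <= (- l) 0 j.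
  rewrite /unstable_index mxE /l; case: split_ordP => i -> // _.
  by rewrite row_mxEl lerNr; apply: le_trans (lam_le i) _; rewrite lerN2 (le_trans gam_s).
have l_u i : (- l) 0 (rshift ds.+1 i) <= - gam.
  rewrite mxE row_mxEr; have := mu_le i; rewrite mxE => /le_trans; apply.
  by rewrite lerN2 (le_trans gam_u).
have l_u' j : stable_index j = None -> gam <= l 0 j.
  rewrite /stable_index /l; case: split_ordP => i -> // _.
  rewrite row_mxEr -lerN2; have := mu_le i; rewrite mxE => /le_trans; apply.
  by rewrite lerN2 (le_trans gam_u).
have c0N : no_low_terms (fun m => - c m) by move=> m m2; rewrite c0// oppr0.
have cFN : analytic_at_origin (fun m => - c m) (fun z => - F z).
  by apply: filterS cF => z; exact: pseries_cvgN.
have c_boundN : coef_sum_le (fun m => - c m) (2 * rho) (gam * rho / d%:R).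
  move=> N; apply: le_trans (c_bound N); rewrite le_eqVlt; apply/orP; left.
  by apply/eqP; apply: eq_bigr => m _; rewrite normrN.
have := stable_manifold (@stable_indexE ds.+1 du.+1) rho0 gam0 l_s l_u' div_s c0 cF c_bound.
rewrite lamE rhoE /= => -[alpha [phi [Js [Ks [rs [alpha0 phi_cvg phi_par phi_tail]]]]]].
move=> [rs0 [phi00 phiP]].
(* The unstable manifold is the stable manifold of the reversed field. *)
have := stable_manifold (@unstable_indexE ds.+1 du.+1) rho0 gam0 l_u l_s' div_u c0N cFN c_boundN.
rewrite muE rhoE /= => -[beta [psi [Ju [Ku [ru [beta0 psi_cvg psi_par psi_tail]]]]]].
move=> [ru0 [psi00 psiP]].
exists r, alpha, beta, phi, psi.
pose X := vfield (Lambda lam mu) F; rewrite -/X.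
have XN z : vfield (diag_mx (- l)) (fun z => - F z) z = - X z.
  by rewrite /X /vfield /Lambda -/l linearN/= mulmxN opprD.
split; [|split; [|split]].
- split=> // O [Ol _] k.
  exists (radius_code d ds.+1 du.+1 O [:: n1; B; k]); first exact: eP.
  by apply: radius_code_correct => //.
- by split.
- split.
  + move: phi_par; rewrite (_ : (fun x => emb _ x + phi x) = (fun x => embed_s du.+1 x + phi x)) //.
    by apply/funext => x; rewrite emb_stable.
  + move: psi_par; rewrite (_ : (fun x => emb _ x + psi x) =
                 (fun x => embed_u ds.+1 x + psi x)); last first.
      by apply/funext => x; rewrite emb_unstable.
    rewrite (_ : local_stable_set _ = local_unstable_set X)//.
    apply/funext => N; rewrite local_unstable_set_reverse; congr local_stable_set.
    by apply/funext => z; rewrite XN.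
  + exists (fun z => pullback (Theta phi psi) X z - z *m Lambda lam mu).
    apply/nbhs0_rowP; exists (Num.min rs ru); first by rewrite lt_min rs0.
    move=> z; rewrite lt_min => /andP[zs zu].
    have zsl : `|lsubmx z| < rs := le_lt_trans (norm_lsubmx z) zs.
    have zur : `|rsubmx z| < ru := le_lt_trans (norm_rsubmx z) zu.
    have [Xs Jsle phi_taylor] := phiP _ zsl.
    have [Xu Jule psi_taylor] := psiP _ zur.
    have [] := @Theta_differentiable _ _ _ phi psi (Js (lsubmx z)) (Ju (rsubmx z)) z Ks Ku
      (Num.min (rs - `|lsubmx z|) (ru - `|rsubmx z|)).
    * by rewrite lt_min !subr_gt0 zsl.
    * move=> h; rewrite lt_min => /andP[hs _]; apply: phi_taylor.
      by apply: le_lt_trans (ler_normD _ _) _; rewrite -ltrBrDr.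
    * move=> h; rewrite lt_min => /andP[_ hu]; apply: psi_taylor.
      by apply: le_lt_trans (ler_normD _ _) _; rewrite -ltrBrDr.
    move=> dT JT.
    have Junit := Theta_jacobian_unit Jsle Jule.
    split=> //.
    * by rewrite JT.
    * by rewrite /vfield addrC subrK.
    * move=> [xi _ xiE].
      have XE : X (Theta phi psi z) = z *m Lambda lam mu *m jacobian (Theta phi psi) z.
        have zl : lsubmx z = xi by rewrite -xiE row_mxKl.
        have zr : rsubmx z = 0 by rewrite -xiE row_mxKr.
        have zL : z *m Lambda lam mu = embed_s du.+1 (xi *m diag_mx lam).
          rewrite -xiE /Lambda /embed_s diag_mx_row mul_row_block !mulmx0 mul0mx.
          by rewrite !addr0.
        rewrite JT mulmx_Theta_jacobian zL row_mxKl row_mxKr mul0mx addr0.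
        (* On E_s the derivative of psi is applied to the vector 0. *)
        move: Xs; rewrite !emb_stable -/l -/X zl => <-.
        by rewrite /Theta zl zr psi00 addr0 -{1}xiE.
      by rewrite /pullback XE mulmxK ?subrr// JT.
    * move=> [eta _ etaE].
      have XE : X (Theta phi psi z) = z *m Lambda lam mu *m jacobian (Theta phi psi) z.
        have zl : lsubmx z = 0 by rewrite -etaE row_mxKl.
        have zr : rsubmx z = eta by rewrite -etaE row_mxKr.
        have zL : z *m Lambda lam mu = embed_u ds.+1 (eta *m diag_mx mu).
          rewrite -etaE /Lambda /embed_u diag_mx_row mul_row_block !mulmx0 mul0mx.
          by rewrite !add0r.
        rewrite JT mulmx_Theta_jacobian zL row_mxKl row_mxKr mul0mx add0r.
        move: Xu; rewrite !emb_unstable XN zr linearN/= mulmxN mulNmx => XuN.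
        apply: oppr_inj; rewrite [RHS]opprD
          (_ : - embed_u _ _ = embed_u ds.+1 (- (eta *m diag_mx mu))).
          by rewrite -XuN /Theta zl zr phi00 addr0 -{1}etaE.
        by rewrite /embed_u opp_row_mx oppr0.
      by rewrite /pullback XE mulmxK ?subrr// JT.
- by split=> x xr; [exact: phi_tail|exact: psi_tail].
Qed.
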